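(* Let $H$ be the disjoint union of two non-null graphs $H_1$ and $H_2$. Then $$c_{\infty}(H) \leq \max\{c_\infty(H_2),\; c_{\infty}(H_1) + \tau(H_2)\},$$ and in particular $$c_\infty(H) \leq c_\infty(H_1)+c_\infty(H_2)+1.$$
   Context: All graphs are finite and simple. A graph $H$ is a minor of $G$ if a graph isomorphic to $H$ can be obtained from a subgraph of $G$ by contracting edges. For a non-null graph $G$, $v(G)$ and $e(G)$ are its numbers of vertices and edges and $d(G)=e(G)/v(G)$ is its density. For a graph $H$, $c_\infty(H)=\lim_{n\to\infty}\max d(G)$, where the maximum is over all graphs $G$ on $n$ vertices not containing $H$ as a minor (the asymptotic extremal function of $H$). $\tau(H)$ denotes the vertex cover number of $H$: the minimum size of a set $X\subseteq V(H)$ such that $H-X$ has no edges. *)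

(* Defs.v *)
From mathcomp Require Import all_boot all_order all_algebra.
From mathcomp Require Import all_classical all_reals all_analysis.

Set Implicit Arguments.
Unset Strict Implicit.
Unset Printing Implicit Defensive.

Import Order.TTheory GRing.Theory Num.Theory.
Import numFieldNormedType.Exports.

Record sgraph := SGraph {
  vertex :> finType;
  adj : rel vertex;
  adj_sym : symmetric adj;
  adj_irr : irreflexive adj }.

Definition edges (G : sgraph) : {set {set G}} :=
  [set e : {set G} |
    [exists x : G, exists y : G, adj x y && (e == [set x; y])]]%SET.

Definition nedges (G : sgraph) : nat := #|edges G|.

Definition graph_iso (G K : sgraph) : Prop :=
  exists2 f : G -> K, bijective f & forall x y, adj (f x) (f y) = adj x y.

(* [S] is isomorphic to a (not necessarily induced) subgraph of [G]. *)
Definition subgraph (S G : sgraph) : Prop :=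
  exists2 f : S -> G, injective f & forall x y, adj x y -> adj (f x) (f y).

Section Contraction.
Variables (G : sgraph) (u v : G).

(* The vertex [v] is removed and [u] stands for the vertex obtained by
   identifying [u] and [v]; loops and parallel edges are discarded. *)
Definition contract_adj : rel {x : G | x != v} := fun x y =>
  (val x != val y) &&
  [|| adj (val x) (val y),
      (val x == u) && adj v (val y) |
      (val y == u) && adj (val x) v].

Lemma contract_adj_sym : symmetric contract_adj.
Proof.
move=> x y; rewrite /contract_adj eq_sym [adj (val x) (val y)]adj_sym.
by rewrite [adj v (val y)]adj_sym [adj (val x) v]adj_sym [X in _ || X]orbC.
Qed.

Lemma contract_adj_irr : irreflexive contract_adj.
Proof. by move=> x; rewrite /contract_adj eqxx. Qed.

Definition contract_edge : sgraph := SGraph contract_adj_sym contract_adj_irr.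

End Contraction.

Inductive contracts_to : sgraph -> sgraph -> Prop :=
| contracts_refl (G : sgraph) : contracts_to G G
| contracts_step (G K : sgraph) (u v : G) :
    adj u v -> contracts_to (contract_edge u v) K -> contracts_to G K.

Definition minor (H G : sgraph) : Prop :=
  exists S K : sgraph, [/\ subgraph S G, contracts_to S K & graph_iso H K].

Section DisjointUnion.
Variables G1 G2 : sgraph.

Definition dunion_adj : rel (G1 + G2)%type := fun x y =>
  match x, y with
  | inl x1, inl y1 => adj x1 y1
  | inr x2, inr y2 => adj x2 y2
  | _, _ => false
  end.

Lemma dunion_adj_sym : symmetric dunion_adj.
Proof. by move=> [x|x] [y|y] //=; rewrite adj_sym. Qed.

Lemma dunion_adj_irr : irreflexive dunion_adj.
Proof. by move=> [x|x] /=; rewrite adj_irr. Qed.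

Definition dunion : sgraph := SGraph dunion_adj_sym dunion_adj_irr.

End DisjointUnion.

Definition vertex_cover (H : sgraph) (X : {set H}) : bool :=
  [forall x in ~: X, forall y in ~: X, ~~ adj x y]%SET.

Definition tau (H : sgraph) : nat :=
  #|[arg min_(X < [set: H]%SET | vertex_cover X) #|X|]|.

Lemma vertex_coverT (H : sgraph) : vertex_cover [set: H]%SET.
Proof. by apply/forall_inP => x; rewrite !inE. Qed.

Local Open Scope classical_set_scope.
Local Open Scope ring_scope.

Section ExtremalFunction.
Variable R : realType.

Definition density (G : sgraph) : R := (nedges G)%:R / #|G|%:R.

Definition minor_free_densities (H : sgraph) (n : nat) : set R :=
  [set x | exists G : sgraph, [/\ #|G| = n, ~ minor H G & density G = x]].

(* When nonempty, this set has a maximum (see [max_densityP]), which is its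
   supremum. It is empty iff every [n]-vertex graph contains [H] as a minor; for
   [n >= #|H|] this happens iff [H] has no edges. The maximum over the empty set
   is then taken to be 0, as [sup set0 = 0]. *)
Definition max_density (H : sgraph) (n : nat) : R :=
  sup (minor_free_densities H n).

Lemma nedges_le (G : sgraph) : (nedges G <= 2 ^ #|G|)%N.
Proof.
rewrite -cardsT -card_powerset; apply: subset_leq_card.
by apply/fintype.subsetP => A _; rewrite powersetE; apply: finset.subsetT.
Qed.

Lemma max_densityP (H : sgraph) (n : nat) :
  minor_free_densities H n !=set0 ->
  minor_free_densities H n (max_density H n) /\
  ubound (minor_free_densities H n) (max_density H n).
Proof.
pose P k := `[< exists G : sgraph, [/\ #|G| = n, ~ minor H G & nedges G = k] >].
move=> [_ [G [Gn HG _]]].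
have exP : exists k, P k by exists (nedges G); apply/asboolP; exists G.
have leP k : P k -> (k <= 2 ^ n)%N.
  by case/asboolP => K [<- _ <-]; exact: nedges_le.
have [m /asboolP[K [Kn HK Km]] mmax] := ex_maxnP exP leP.
have inK : minor_free_densities H n (density K) by exists K.
have ubK : ubound (minor_free_densities H n) (density K).
  move=> _ [L [Ln HL <-]]; rewrite /density Kn Ln Km ler_wpM2r ?invr_ge0 //.
  by rewrite ler_nat; apply: mmax; apply/asboolP; exists L.
suff -> : max_density H n = density K by [].
apply/eqP; rewrite eq_le; apply/andP; split.
  by apply: ge_sup => //; exists (density K).
by apply: ub_le_sup => //; exists (density K).
Qed.

(* [limn] is total; the sequence [max_density H] does converge, since proper
   minor-closed classes have limiting densities (Kapadia and Norin). *)
Definition c_infty (H : sgraph) : R := limn (max_density H).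

End ExtremalFunction.

(* Main.v *)
Require Import Defs.
From mathcomp Require Import all_boot all_order all_algebra.
From mathcomp Require Import all_classical all_reals all_analysis.
From mathcomp Require Import zify ring lra.
Import Order.TTheory GRing.Theory Num.Theory.
Import numFieldNormedType.Exports.

(* Let [P] be a connected graph with a set [T] of roots attached to it, and let a
   fan be obtained by gluing any number of copies of [P] along [T]. The key fact,
   a weak form of a structural lemma of Eppstein, is that if [H]-minor-free graphs
   of density at least [d] exist on arbitrarily many vertices, then for every
   [d' < d] some [P] and [T] have all fans [H]-minor-free and at least [d'] edges
   per vertex of [P]. In particular [max_density H] converges.

   To find the fans in a large dense [H]-minor-free graph, discard the vertices
   of medium degree, and let [A] be the set of those of very large degree.
   By Mader's theorem, minors are sparse, so repeatedly merging the clusters of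
   a partition of the low-degree vertices along heavy star forests leaves
   clusters of bounded size with few edges between them. Contracting clusters
   into [A], one sees that most clusters have boundedly many neighbours in [A],
   and that only O(|A|) sets occur as such neighbourhoods. As [A] is tiny
   compared to the number of clusters, most clusters have many copies with the
   same neighbourhood, and such copies form a fan.

   Now let all fans on [P], [T] avoid [H1 + H2], with more than
   [max (c H2) (c H1 + tau H2)] edges per vertex of [P]. If [|T| <= tau H2], then
   a fan contains an [H2] minor, and other copies of [P], without the roots, still
   are dense enough for an [H1] minor. If [|T| > tau H2], then [tau H2] roots,
   playing the role of a vertex cover, and some copies of [P] have an [H2] minor,
   and the other copies with the other roots contain [H1]. The second bound
   follows from [tau H2 - 1 <= c H2], because a fan of single vertices attached to
   [tau H2 - 1] roots has a vertex cover of size less than [tau H2]. *)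

Set Implicit Arguments.
Unset Strict Implicit.
Unset Printing Implicit Defensive.

(** * Minors and branch sets *)

Section Models.
Import mathcomp.boot.fintype mathcomp.boot.finset.
Local Open Scope set_scope.
Local Open Scope nat_scope.

Lemma connect_homo (T T' : finType) (e : rel T) (e' : rel T') (f : T -> T') :
  (forall x y, e x y -> connect e' (f x) (f y)) ->
  forall x y, connect e x y -> connect e' (f x) (f y).
Proof.
move=> ef x y /connectP[p]; elim: p x => [|z p IH] x /= => [_ ->|].
  exact: connect0.
by case/andP=> /ef xz pz /(IH _ pz); apply: connect_trans.
Qed.

Definition adj_in (G : sgraph) (X : {set G}) : rel G :=
  [rel u v | [&& adj u v, u \in X & v \in X]].

Definition conn (G : sgraph) (X : {set G}) :=
  {in X &, forall x y, connect (adj_in X) x y}.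

Lemma adj_inE (G : sgraph) (X : {set G}) x y :
  adj_in X x y = [&& adj x y, x \in X & y \in X].
Proof. by []. Qed.

Lemma adj_in_sym (G : sgraph) (X : {set G}) : connect_sym (adj_in X).
Proof.
apply: sym_connect_sym => x y; rewrite !adj_inE.
by rewrite adj_sym [(y \in X) && _]andbC.
Qed.

Lemma adj_in_sub (G : sgraph) (X Y : {set G}) : X \subset Y ->
  subrel (connect (adj_in X)) (connect (adj_in Y)).
Proof.
move=> /subsetP XY; apply: connect_sub => x y /and3P[xy xX yX].
by apply: connect1; rewrite adj_inE xy !XY.
Qed.

Definition fib (G : sgraph) (V : finType) (phi : G -> option V) (k : V) :=
  [set x | phi x == Some k].

Definition touch (G : sgraph) (V : finType) (phi : G -> option V) : rel V :=
  [rel k l | [exists x, exists y,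
     [&& phi x == Some k, phi y == Some l & adj x y]]].

Lemma touchP (G : sgraph) (V : finType) (phi : G -> option V) k l :
  reflect (exists x y, [/\ phi x = Some k, phi y = Some l & adj x y])
    (touch phi k l).
Proof.
apply: (iffP existsP) => [[x /existsP[y /and3P[/eqP ? /eqP ? ?]]]|].
  by exists x, y.
by move=> [x [y [xk yl xy]]]; exists x; apply/existsP; exists y; rewrite xk yl !eqxx.
Qed.

Lemma touch_sym (G : sgraph) (V : finType) (phi : G -> option V) :
  symmetric (touch phi).
Proof.
by move=> k l; apply/touchP/touchP => -[x [y [? ? ?]]]; exists y, x; rewrite adj_sym.
Qed.

(** The branch-set form of the minor relation: [fib phi h] is the branch set of [h], and [None]
    marks the vertices left out. Unlike sequences of contractions, such maps compose directly. *)
Definition model (H G : sgraph) := exists phi : G -> option H,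
  [/\ forall h, exists x, phi x = Some h,
      forall h, conn (fib phi h) &
      forall h h', adj h h' -> touch phi h h'].

Lemma subgraph_model (S G : sgraph) : subgraph S G -> model S G.
Proof.
move=> [f finj fadj]; exists (fun x => [pick s | f s == x]); have fK s :
    [pick s' | f s' == f s] = Some s.
  by case: pickP => [s' /eqP/finj-> //|/(_ s)]; rewrite eqxx.
have fE x s : [pick s' | f s' == x] = Some s -> x = f s.
  by case: pickP => // s' /eqP<- [->].
split=> [s|s x y|s s' ss'].
- by exists (f s).
- rewrite !inE => /eqP/fE-> /eqP/fE->; exact: connect0.
- by apply/touchP; exists (f s), (f s'); rewrite !fK; split=> //; apply: fadj.
Qed.

Lemma iso_subgraph (H K : sgraph) : graph_iso H K -> subgraph H K.
Proof.
by move=> [f fbij fadj]; exists f => [|x y]; [apply: bij_inj | rewrite fadj].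
Qed.

Lemma subgraph_trans (A B D : sgraph) :
  subgraph A B -> subgraph B D -> subgraph A D.
Proof.
move=> [f finj fadj] [g ginj gadj]; exists (g \o f); first exact: inj_comp.
by move=> x y /fadj/gadj.
Qed.

Lemma model_trans (H K G : sgraph) : model H K -> model K G -> model H G.
Proof.
move=> [phi [phi0 phiC phiE]] [psi [psi0 psiC psiE]].
pose chi x := obind phi (psi x).
have chiE x h : chi x = Some h -> exists2 k, psi x = Some k & phi k = Some h.
  by rewrite /chi; case: (psi x) => //= k; exists k.
have psi_chi x k h : psi x = Some k -> phi k = Some h -> chi x = Some h.
  by rewrite /chi => ->.
have chi_fib k h : phi k = Some h -> fib psi k \subset fib chi h.
  move=> kh; apply/subsetP=> x; rewrite !inE => /eqP xk.
  by rewrite (psi_chi _ _ _ xk kh).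
exists chi; split.
- move=> h; have [k kh] := phi0 h; have [x xk] := psi0 k; exists x; exact: psi_chi kh.
- move=> h x y; rewrite !inE => /eqP xh /eqP yh.
  have [k xk kh] := chiE _ _ xh; have [l yl lh] := chiE _ _ yh.
  (* Lift a walk in the branch set of [h] in [K]: each of its edges is realised by an edge of [G],
     and consecutive ones are linked inside the connected sets [fib psi k]. *)
  have := phiC h k l; rewrite !inE kh lh eqxx => /(_ isT isT) /connectP[p].
  elim: p k x kh xk xh => [|k' p IH] k x kh xk xh /=.
    move=> _ lk; apply: (adj_in_sub (chi_fib _ _ kh)).
    by apply: psiC; rewrite inE ?xk ?yl ?lk.
  case/andP=> /and3P[kk' _]; rewrite inE => /eqP k'h pk' lE.
  have /touchP[u [v [uk vk' uv]]] := psiE _ _ kk'.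
  have uh := psi_chi _ _ _ uk kh; have vh := psi_chi _ _ _ vk' k'h.
  apply: (@connect_trans _ _ u).
    by apply: (adj_in_sub (chi_fib _ _ kh)); apply: psiC; rewrite inE ?uk ?xk.
  apply: (@connect_trans _ _ v).
    by apply: connect1; rewrite adj_inE uv !inE uh vh eqxx.
  exact: IH k'h vk' vh pk' lE.
- move=> h h' /phiE /touchP[k [l [kh lh' /psiE /touchP[x [y [xk yl xy]]]]]].
  apply/touchP; exists x, y; split=> //; [exact: psi_chi kh|exact: psi_chi lh'].
Qed.

Lemma card_contract_edge (G : sgraph) (u v : G) :
  #|contract_edge u v|.+1 = #|G|.
Proof.
rewrite card_sig (eq_card (B := predC1 v)) // cardC1 prednK //.
by apply/card_gt0P; exists v.
Qed.

Lemma contract_edgeE (G : sgraph) (u v : G) (x y : contract_edge u v) :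
  adj x y = (val x != val y) && [|| adj (val x) (val y),
    (val x == u) && adj v (val y) | (val y == u) && adj (val x) v].
Proof. by []. Qed.

Lemma contract_model (G : sgraph) (u v : G) : adj u v ->
  model (contract_edge u v) G.
Proof.
move=> uv; have nuv : u != v by apply: contraTneq uv => ->; rewrite adj_irr.
(* The branch set of [u] is the pair of [u] and [v]; all others are singletons. *)
pose r x := if x == v then u else x.
have rv x : r x != v by rewrite /r; case: (eqVneq x v).
exists (fun x => Some (exist (fun x => x != v) (r x) (rv x))).
have rE x (k : contract_edge u v) :
    (Some (exist (fun x => x != v) (r x) (rv x)) == Some k) = (r x == val k).
  by rewrite (inj_eq Some_inj) -val_eqE.
split.
- case=> x xv; exists x; congr Some; apply: val_inj => /=.
  by rewrite /r (negbTE xv).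
- move=> k; have to_k x : r x = val k ->
      connect (adj_in (fib (fun x => Some (exist (fun x => x != v) (r x) (rv x))) k)) x (val k).
    move=> xk; have [xv|xv] := eqVneq x v; last first.
      by move: xk; rewrite /r (negbTE xv) => ->; apply: connect0.
    have ku : u = val k by rewrite -xk /r xv eqxx.
    apply: connect1; rewrite adj_inE xv -ku adj_sym uv !inE !rE /r eqxx.
    by rewrite (negbTE nuv) ku eqxx.
  move=> x y; rewrite !inE !rE => /eqP/to_k xk /eqP/to_k yk.
  by apply: connect_trans xk _; rewrite adj_in_sym.
- move=> k l /andP[_ kl]; apply/touchP.
  have rk (m : contract_edge u v) : r (val m) = val m.
    by rewrite /r (negbTE (valP m)).
  have P x y : r x = val k -> r y = val l -> adj x y -> exists x0 y0,
    [/\ Some (exist (fun x => x != v) (r x0) (rv x0)) = Some k,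
        Some (exist (fun x => x != v) (r y0) (rv y0)) = Some l & adj x0 y0].
    by move=> xk yl xy; exists x, y; split=> //; apply/eqP; rewrite rE ?xk ?yl.
  have ruv : r v = u by rewrite /r eqxx.
  case/or3P: kl => [kl|/andP[/eqP ku vl]|/andP[/eqP lu kv]].
  + by apply: P kl; rewrite rk.
  + by apply: (P v (val l)) => //; rewrite ?rk ?ruv.
  + by apply: (P (val k) v) => //; rewrite ?rk ?ruv.
Qed.

Lemma model_refl (G : sgraph) : model G G.
Proof. by apply: subgraph_model; exists id. Qed.

Lemma contracts_to_model (G K : sgraph) : contracts_to G K -> model K G.
Proof.
elim=> {G K} [G|G K u v uv _ IH]; first exact: model_refl.
exact: model_trans IH (contract_model uv).
Qed.

Lemma minor_model (H G : sgraph) : minor H G -> model H G.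
Proof.
move=> [S [K [/subgraph_model SG /contracts_to_model KS HK]]].
apply: model_trans (model_trans KS SG).
exact/subgraph_model/iso_subgraph.
Qed.

(** Induction on the number of vertices. If two vertices share a label, connectivity of the class
    yields an edge inside it, and contracting that edge preserves the assumptions; an injective
    [phi] is an isomorphism. Totality of [phi] and the exact description of [adj] are what make the
    final graph isomorphic to [H] rather than merely contain it. *)
Lemma exact_model_contracts (H S : sgraph) (phi : S -> H) :
  (forall h, exists x, phi x = h) ->
  (forall h, conn (fib (Some \o phi) h)) ->
  (forall h h', adj h h' = (h != h') && touch (Some \o phi) h h') ->
  exists2 K, contracts_to S K & graph_iso H K.
Proof.
have [n] := ubnP #|S|; elim: n S phi => // n IH S phi leSn phi0 phiC phiE.
have [phi_inj|/injectivePn] := boolP (injectiveb phi).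
  exists S; first exact: contracts_refl.
  have {}phi_inj := injectiveP _ phi_inj.
  have /fin_all_exists [f fK] := phi0.
  have phiK : cancel phi f by move=> x; apply: phi_inj; rewrite fK.
  exists f; first by exists phi.
  move=> h h'; rewrite phiE; apply/idP/andP => [ff|[hh' /touchP]].
    split; last by apply/touchP; exists (f h), (f h'); rewrite /= !fK.
    by apply: contraTneq ff => ->; rewrite adj_irr.
  by move=> [x [y [/= [<-] [<-] xy]]]; rewrite !phiK.
move=> [x [y xy eqxy]].
have [u [v [uv uveq]]] : exists u v, adj u v /\ phi u = phi v.
  have := phiC (phi x) x y; rewrite !inE /= eqxy eqxx => /(_ isT isT).
  case/connectP=> -[/= _ yx|z p /= /andP[/and3P[xz xx zx] _] _].
    by rewrite yx eqxx in xy.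
  exists x, z; split=> //; move: xx zx; rewrite !inE /=.
  by rewrite !(inj_eq Some_inj) => /eqP-> /eqP->.
have nuv : u != v by apply: contraTneq uv => ->; rewrite adj_irr.
have ltK : #|contract_edge u v| < n.
  by rewrite -ltnS card_contract_edge.
pose r x := if x == v then u else x.
have rv z : r z != v by rewrite /r; case: (eqVneq z v).
pose rr z : contract_edge u v := exist (fun x => x != v) (r z) (rv z).
have phir z : phi (r z) = phi z by rewrite /r; case: eqP => // ->.
have rr_val (k : contract_edge u v) : rr (val k) = k.
  by apply: val_inj; rewrite /= /r (negbTE (valP k)).
have rr_adj z t : r z != r t -> adj z t -> adj (rr z) (rr t).
  rewrite contract_edgeE /= => -> /=; rewrite /r.
  case: (eqVneq z v) => [->|_]; case: (eqVneq t v) => [->|_] //.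
  - by rewrite adj_irr.
  - by rewrite eqxx => ->; rewrite orbT.
  - by rewrite eqxx => ->; rewrite !orbT.
  - by move=> ->.
suff [K cK iK] : exists2 K, contracts_to (contract_edge u v) K & graph_iso H K.
  by exists K => //; apply: contracts_step uv cK.
pose psi (x : contract_edge u v) : H := phi (val x).
apply: (IH _ psi ltK).
- by move=> h; have [z zh] := phi0 h; exists (rr z); rewrite /psi /= phir.
- move=> h k l; rewrite !inE => kh lh; rewrite -(rr_val k) -(rr_val l).
  have : connect (adj_in (fib (Some \o phi) h)) (val k) (val l).
    by apply: phiC; rewrite inE.
  apply: connect_homo => z t /and3P[zt zh th].
  have [E|E] := eqVneq (r z) (r t).
    have -> : rr z = rr t by apply: val_inj.
    exact: connect0.
  apply: connect1; apply/and3P; split; first exact: rr_adj.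
    by move: zh; rewrite !inE /= /psi /= phir.
  by move: th; rewrite !inE /= /psi /= phir.
- move=> h h'; rewrite phiE; case: (eqVneq h h') => //= hh'.
  apply/touchP/touchP => /= -[z [t [[zh] [th'] zt]]].
    exists (rr z), (rr t); rewrite /psi /= !phir zh th'; split=> //.
    apply: rr_adj zt; apply: contraNneq hh' => E.
    by rewrite -zh -th' -(phir z) -(phir t) E.
  rewrite /psi in zh th'.
  case/andP: zt => zt /or3P[zt'|/andP[/eqP zu vt]|/andP[/eqP tu zv]].
  + by exists (val z), (val t); rewrite zh th'.
  + by exists v, (val t); rewrite th' -uveq -zu zh.
  + by exists (val z), v; rewrite zh -uveq -tu th'.
Qed.

Section ModelMinor.
Variables (H G : sgraph) (phi : G -> option H).

(** Unlabelled vertices are deleted, and so are edges between branch sets of nonadjacent vertices of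
    [H], to meet the exactness required by [exact_model_contracts]. *)
Definition model_support_adj : rel {x : G | phi x} := fun x y =>
  adj (val x) (val y) && ((phi (val x) == phi (val y)) ||
    (if phi (val x) is Some h then
     if phi (val y) is Some h' then adj h h' else false else false)).

Lemma model_support_sym : symmetric model_support_adj.
Proof.
move=> x y; rewrite /model_support_adj adj_sym [phi (val x) == _]eq_sym.
by case: (phi (val x)) (phi (val y)) => [h|] [h'|] //; rewrite [adj h h']adj_sym.
Qed.

Lemma model_support_irr : irreflexive model_support_adj.
Proof. by move=> x; rewrite /model_support_adj adj_irr. Qed.

Definition model_support := SGraph model_support_sym model_support_irr.

Lemma model_supportE (x y : model_support) : adj x y =
  adj (val x) (val y) && ((phi (val x) == phi (val y)) ||
    (if phi (val x) is Some h then
     if phi (val y) is Some h' then adj h h' else false else false)).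
Proof. by []. Qed.

End ModelMinor.

Lemma model_minor (H G : sgraph) : model H G -> minor H G.
Proof.
move=> [phi [phi0 phiC phiE]].
have def (x : {x : G | phi x}) : {h | phi (val x) = Some h}.
  by case: x => x /=; case: (phi x) => // h _; exists h.
pose psi (x : model_support phi) := projT1 (def x).
have psiE (x : model_support phi) : phi (val x) = Some (psi x).
  by rewrite /psi; case: (def x).
have lift x h : phi x = Some h -> exists2 k : model_support phi, val k = x & psi k = h.
  move=> xh; have px : phi x by rewrite xh.
  exists (exist (fun x => phi x) x px) => //.
  by apply: Some_inj; rewrite -psiE.
have [K cK iK] : exists2 K, contracts_to (model_support phi) K & graph_iso H K.
  apply: (exact_model_contracts (phi := psi)).
  - by move=> h; have [x /lift[k _ <-]] := phi0 h; exists k.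
  - move=> h k l; rewrite !inE /= !(inj_eq Some_inj) => /eqP kh /eqP lh.
    have := phiC h (val k) (val l); rewrite !inE !psiE kh lh eqxx => /(_ isT isT).
    pose f x : model_support phi := insubd k x.
    have fk (m : model_support phi) : f (val m) = m by apply: valKd.
    move=> kl; rewrite -(fk k) -(fk l); move: kl; apply: connect_homo => x y.
    move=> /and3P[xy]; rewrite !inE => /eqP /[dup] xh /lift[kx kxE kxh].
    move=> /eqP /[dup] yh /lift[ky kyE kyh].
    rewrite -kxE -kyE !fk; apply: connect1; rewrite adj_inE !inE /comp kxh kyh eqxx.
    by rewrite model_supportE !psiE kxh kyh eqxx kxE kyE xy.
  - move=> h h'; apply/idP/andP => [hh'|[hh' /touchP]].
      split; first by apply: contraTneq hh' => ->; rewrite adj_irr.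
      have /touchP[x [y [/[dup] xh /lift[k kx kh] /[dup] yh /lift[l ly lh'] xy]]] :=
        phiE _ _ hh'.
      apply/touchP; exists k, l; rewrite /= kh lh'; split=> //.
      rewrite -[model_support_adj k l]/(adj k l).
      by rewrite model_supportE !psiE kh lh' kx ly xy hh' orbT.
    move=> [k [l [/= [kh] [lh'] /andP[_]]]].
    by rewrite !psiE kh lh' (inj_eq Some_inj) (negbTE hh').
exists (model_support phi), K; split=> //.
by exists val => [|x y /andP[]]; first exact: val_inj.
Qed.

Lemma minor_subgraph (H S G : sgraph) : subgraph S G -> minor H S -> minor H G.
Proof.
move=> SG [S' [K [S'S cK iK]]]; exists S', K; split=> //.
exact: subgraph_trans SG.
Qed.

End Models.

(** * Mader's theorem *)

Section Sparsity.
Import mathcomp.boot.fintype mathcomp.boot.finset.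
Local Open Scope set_scope.
Local Open Scope nat_scope.

Definition arcs (G : sgraph) : nat := \sum_(x : G) \sum_(y : G) adj x y.

Lemma sum_bool_card (T : finType) (P Q : pred T) :
  \sum_(x | P x) (Q x : nat) = #|[set x | P x && Q x]|.
Proof.
rewrite cardsE -sum1_card big_mkcondr /=.
by apply: eq_bigr => x _; case: (Q x).
Qed.

Lemma arcs_card (G : sgraph) : arcs G = #|[set e : G * G | adj e.1 e.2]|.
Proof.
rewrite /arcs pair_big /= (sum_bool_card xpredT (fun e : G * G => adj e.1 e.2)).
by apply: eq_card => e; rewrite !inE.
Qed.

Lemma arcs_nedges (G : sgraph) : arcs G = (nedges G).*2.
Proof.
pose D : {set G * G} := [set e | adj e.1 e.2 && (enum_rank e.1 < enum_rank e.2)].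
have rank_neq (x y : G) : adj x y -> enum_rank x != enum_rank y.
  by move=> xy; rewrite (inj_eq enum_rank_inj); apply: contraTneq xy => ->; rewrite adj_irr.
have -> : nedges G = #|D|.
  rewrite /nedges.
  have <- : [set [set e.1; e.2] | e in D] = edges G.
    apply/setP=> X; rewrite inE; apply/imsetP/existsP => [[[x y]]|[x /existsP[y /andP[xy /eqP->]]]].
      rewrite inE /= => /andP[xy _] ->; exists x; apply/existsP; exists y.
      by rewrite xy eqxx.
    case: (ltngtP (enum_rank x) (enum_rank y)) => r.
    - by exists (x, y); rewrite ?inE /= ?xy.
    - by exists (y, x); rewrite ?inE /= ?[adj y x]adj_sym ?xy //= finset.setUC.
    - by move: (rank_neq _ _ xy); rewrite -val_eqE /= r eqxx.
  rewrite card_in_imset // => -[x y] [z t]; rewrite !inE /=.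
  move=> /andP[xy rxy] /andP[zt rzt] E.
  have : x \in [set z; t] by rewrite -E !inE eqxx.
  have : y \in [set z; t] by rewrite -E !inE eqxx orbT.
  rewrite !inE => /orP[]/eqP yE /orP[]/eqP xE; subst x y => //.
  + by rewrite ltnn in rxy.
  + by move: rxy; rewrite ltnNge (ltnW rzt).
  + by rewrite ltnn in rxy.
pose swap (e : G * G) := (e.2, e.1).
have swapK : involutive swap by case.
rewrite arcs_card -addnn -[X in _ = X + _](card_imset _ (inv_inj swapK)).
rewrite -cardsUI -[LHS]addn0; congr (_ + _).
  apply: eq_card => -[x y]; rewrite !inE /=.
  have -> : ((x, y) \in [set swap x | x in D]) = ((y, x) \in D).
    by rewrite -[(x, y)]/(swap (y, x)) mem_imset //; apply: inv_inj swapK.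
  rewrite inE /= [adj y x]adj_sym -andb_orr orbC.
  case: (boolP (adj x y)) => //= /rank_neq; rewrite -val_eqE /=.
  by case: ltngtP.
apply/esym/eqP; rewrite cards_eq0; apply/eqP/setP => -[x y]; rewrite !inE /=.
have -> : ((x, y) \in [set swap x | x in D]) = ((y, x) \in D).
  by rewrite -[(x, y)]/(swap (y, x)) mem_imset //; apply: inv_inj swapK.
by rewrite inE /=; case: ltngtP; rewrite ?andbF.
Qed.

Lemma arcs_subgraph (S G : sgraph) : subgraph S G -> arcs S <= arcs G.
Proof.
move=> [f finj fadj]; rewrite !arcs_card.
have ginj : injective (fun e : S * S => (f e.1, f e.2)).
  by move=> [x y] [z t] [/finj-> /finj->].
rewrite -(card_imset _ ginj); apply: subset_leq_card; apply/subsetP => e.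
by case/imsetP => -[x y]; rewrite inE /= => /fadj xy ->; rewrite inE.
Qed.

Lemma sum_sig (T : finType) (P : pred T) (F : T -> nat) :
  \sum_(x : {x | P x}) F (val x) = \sum_(x | P x) F x.
Proof.
rewrite [RHS](reindex_omap (val : {x | P x} -> T) insub) /=; last first.
  by move=> x Px; rewrite insubT.
by apply: eq_bigl => x; rewrite (valP x) valK eqxx.
Qed.

(** Contraction loses the edge [uv] itself and, for each common neighbour, one of two edges that
    become parallel; each lost edge counts for two arcs. *)
Lemma arcs_contract (G : sgraph) (u v : G) : adj u v ->
  arcs G = arcs (contract_edge u v) + 2 + 2 * \sum_(y : G) (adj u y && adj v y).
Proof.
move=> uv; have nuv : u != v by apply: contraTneq uv => ->; rewrite adj_irr.
have split_sum (F : G -> nat) :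
    \sum_x F x = F v + F u + \sum_(x | (x != v) && (x != u)) F x.
  by rewrite (bigD1 v) //= (bigD1 u) //= addnA.
have sum_contract (F : G -> nat) :
    \sum_(x : contract_edge u v) F (val x) = F u + \sum_(x | (x != v) && (x != u)) F x.
  by rewrite (sum_sig _ F) (bigD1 u).
(* The adjacency of the contracted graph, extended to all of [G] so that its sums can be split like
   those of [G]. *)
pose a' (x y : G) : nat := (x != y) && [|| adj x y,
    (x == u) && adj v y | (y == u) && adj x v].
have -> : arcs (contract_edge u v) =
    \sum_(x : contract_edge u v) \sum_(y : contract_edge u v) a' (val x) (val y).
  by [].
under eq_bigr do rewrite (sum_contract (a' _)).
rewrite (sum_contract (fun x => a' x u + \sum_(y | (y != v) && (y != u)) a' x y)).
rewrite /arcs split_sum !(split_sum (fun y => nat_of_bool (adj _ y))).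
rewrite [\sum_(x | _) \sum_y _](eq_bigr _ (fun x _ => split_sum (fun y => nat_of_bool (adj x y)))).
rewrite (split_sum (fun y => nat_of_bool (adj u y && adj v y))).
rewrite !big_split /= !adj_irr uv [adj v u]adj_sym uv /a' eqxx /=.
pose S1 := \sum_(x | (x != v) && (x != u)) (adj u x : nat).
pose S2 := \sum_(x | (x != v) && (x != u)) (adj v x : nat).
pose S12 := \sum_(x | (x != v) && (x != u)) (adj u x && adj v x : nat).
have E1 : \sum_(x | (x != v) && (x != u)) (adj x u : nat) = S1.
  by apply: eq_bigr => x _; rewrite adj_sym.
have E2 : \sum_(x | (x != v) && (x != u)) (adj x v : nat) = S2.
  by apply: eq_bigr => x _; rewrite adj_sym.
have E3 : \sum_(x | (x != v) && (x != u))
    ((u != x) && [|| adj u x, adj v x | (x == u) && adj u v] : nat) + S12 = S1 + S2.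
  rewrite -!big_split; apply: eq_bigr => x /andP[_ xu]; rewrite [u == x]eq_sym xu (negbTE xu) /=.
  by case: (adj u x); case: (adj v x).
have E4 : \sum_(x | (x != v) && (x != u))
    ((x != u) && [|| adj x u, (x == u) && adj v u | adj x v] : nat)
  = \sum_(x | (x != v) && (x != u))
    ((u != x) && [|| adj u x, adj v x | (x == u) && adj u v] : nat).
  apply: eq_bigr => x /andP[_ xu]; rewrite [u == x]eq_sym xu (negbTE xu) /= orbF.
  by rewrite ![adj x _]adj_sym.
have E5 : \sum_(x | (x != v) && (x != u)) \sum_(y | (y != v) && (y != u)) ((x != y) &&
    [|| adj x y, (x == u) && adj v y | (y == u) && adj x v] : nat) =
  \sum_(x | (x != v) && (x != u)) \sum_(y | (y != v) && (y != u)) (adj x y : nat).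
  apply: eq_bigr => x /andP[_ xu]; apply: eq_bigr => y /andP[_ yu].
  rewrite (negbTE xu) (negbTE yu) !orbF; case: (eqVneq x y) => [->|//].
  by rewrite adj_irr.
rewrite -/S1 -/S2 -/S12 E1 E2 E5.
move: E3 E4; rewrite /=; lia.
Qed.


(** A type of [n.+1] elements built by [option], so that the induction on clique size matches the
    apex added in [complete_model_cone]. *)
Fixpoint opt (n : nat) : finType := if n is n'.+1 then option (opt n') else unit.

Lemma card_opt n : #|opt n| = n.+1.
Proof. by elim: n => [|n IH]; rewrite ?card_unit // card_option IH. Qed.

Section Complete.
Variable T : finType.

Definition complete_adj : rel T := [rel x y | x != y].

Lemma complete_sym : symmetric complete_adj.
Proof. by move=> x y; rewrite /complete_adj /= eq_sym. Qed.

Lemma complete_irr : irreflexive complete_adj.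
Proof. by move=> x; rewrite /complete_adj /= eqxx. Qed.

Definition complete := SGraph complete_sym complete_irr.

End Complete.

Section Induced.
Variables (G : sgraph) (X : {set G}).

Definition induced_adj : rel {x | x \in X} := fun x y => adj (val x) (val y).

Lemma induced_sym : symmetric induced_adj.
Proof. by move=> x y; apply: adj_sym. Qed.

Lemma induced_irr : irreflexive induced_adj.
Proof. by move=> x; apply: adj_irr. Qed.

Definition induced_graph := SGraph induced_sym induced_irr.

Lemma induced_subgraph : subgraph induced_graph G.
Proof. by exists val; first exact: val_inj. Qed.

Lemma card_induced : #|induced_graph| = #|X|.
Proof. by rewrite card_sig; apply: eq_card => x; rewrite inE. Qed.

Lemma arcs_induced : arcs induced_graph = \sum_(x in X) \sum_(y in X) adj x y.
Proof.
rewrite /arcs -(sum_sig (fun x => x \in X) (fun x => \sum_(y in X) adj x y)).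
apply: eq_bigr => x _.
by rewrite -(sum_sig (fun y => y \in X) (fun y => nat_of_bool (adj (val x) y))).
Qed.

End Induced.

(** The vertex [x] alone is the branch set of [None]: it is adjacent to everything the other branch
    sets contain. *)
Lemma complete_model_cone (G : sgraph) (T : finType) (x : G) :
  model (complete T) (induced_graph [set y | adj x y]) -> model (complete (option T)) G.
Proof.
move=> [phi [phi0 phiC phiE]].
pose chi y : option (option T) :=
  if y == x then Some None else
  if insub y is Some k then omap Some (phi k) else None.
have chi_in (k : induced_graph [set y | adj x y]) t : phi k = Some t -> chi (val k) = Some (Some t).
  move=> kt; rewrite /chi valK kt; case: eqP => // E.
  by have := valP k; rewrite E inE adj_irr.
have chiP y t : chi y = Some (Some t) ->
    exists2 k : induced_graph [set y | adj x y], val k = y & phi k = Some t.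
  rewrite /chi; case: eqP => // _; case: insubP => // k _ ky.
  by case kt: (phi k) => [t'|] //= [<-]; exists k.
have chix : chi x = Some None by rewrite /chi eqxx.
have xin (k : induced_graph [set y | adj x y]) : adj x (val k) by have := valP k; rewrite inE.
exists chi; split.
- move=> [t|]; last by exists x.
  by have [k /chi_in] := phi0 t; exists (val k).
- move=> [t|] y z; rewrite !inE.
    move=> /eqP/chiP[k <- kt] /eqP/chiP[l <- lt].
    have := phiC t k l; rewrite !inE kt lt => /(_ (eqxx _) (eqxx _)) {kt lt}.
    apply: connect_homo => {}k {}l /and3P[kl]; rewrite !inE => /eqP/chi_in kt' /eqP/chi_in lt'.
    by apply: connect1; rewrite adj_inE !inE kt' lt' eqxx !andbT.
  have chiN w : chi w = Some None -> w = x.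
    rewrite /chi; case: eqP => // _; case: insubP => // k _ _.
    by case: (phi k).
  by move=> /eqP/chiN-> /eqP/chiN->; apply: connect0.
- move=> [t|] [t'|] // tt'.
  + have /touchP[k [l [/chi_in kt /chi_in lt' kl]]] := phiE t t' tt'.
    by apply/touchP; exists (val k), (val l).
  + have [k /chi_in kt] := phi0 t.
    by apply/touchP; exists (val k), x; rewrite adj_sym.
  + have [k /chi_in kt] := phi0 t'.
    by apply/touchP; exists x, (val k).
Qed.

(* Mader's argument: contracting an edge in fewer than [2 ^ n.+1] triangles
   preserves the bound; if there is no such edge, then the neighbourhood of a
   vertex has large minimum degree. *)
Lemma dense_complete_model n (G : sgraph) :
  0 < #|G| -> 2 ^ n.+1 * #|G| <= arcs G -> model (complete (opt n)) G.
Proof.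
elim: n G => [|n IHn] G.
  case/card_gt0P=> x _ _; exists (fun y => if y == x then Some tt else None).
  split=> [[]|[] y z|[] []] //; first by exists x; rewrite eqxx.
  rewrite !inE; case: (eqVneq y x) => // -> _; case: (eqVneq z x) => // -> _.
  exact: connect0.
have [m] := ubnP #|G|; elim: m G => // m IHm G leGm G0 dense.
have [[u [v [uv few]]]|tri] := pselect (exists u v : G,
    adj u v /\ \sum_(y : G) (adj u y && adj v y) < 2 ^ n.+1).
  apply: model_trans (contract_model uv).
  have := arcs_contract uv; have := card_contract_edge u v => cG aG.
  have arc_gt0 : 0 < #|contract_edge u v|.
    apply/card_gt0P; have nuv : u != v by apply: contraTneq uv => ->; rewrite adj_irr.
    by exists (exist (fun x => x != v) u nuv).
  apply: IHm => //; first by rewrite -ltnS cG.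
  (* The edge lies in at most [2 ^ n.+1 - 1] triangles, so at most [2 ^ n.+2] arcs are lost, which
     is what one vertex fewer allows. *)
  move: dense; rewrite aG -cG mulnS !(expnS _ n.+1); nia.
have [x [y xy]] : exists x y : G, adj x y.
  apply: contrapT => noedge; have : arcs G = 0.
    rewrite /arcs big1 // => x _; rewrite big1 // => y _.
    by case xy: (adj x y) => //; case: noedge; exists x, y.
  by move=> a0; move: dense; rewrite a0 leqn0 muln_eq0 expn_eq0 /= -leqn0 leqNgt G0.
apply: (@complete_model_cone _ _ x); apply: IHn.
  by rewrite card_induced; apply/card_gt0P; exists y; rewrite inE.
rewrite arcs_induced card_induced mulnC -sum_nat_const.
apply: leq_sum => z; rewrite inE => xz.
have -> : \sum_(w in [set y0 | adj x y0]) adj z w = \sum_(w : G) (adj x w && adj z w).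
  rewrite big_mkcond; apply: eq_bigr => w _; rewrite inE.
  by case: (adj x w).
by rewrite leqNgt; apply/negP => few; apply: tri; exists x, z.
Qed.

Lemma mader (H : sgraph) :
  exists2 C, 0 < C & forall G : sgraph, ~ minor H G -> arcs G <= C * #|G|.
Proof.
(* This density forces a clique minor on [#|H|.+1] vertices, which contains [H]. *)
exists (2 ^ #|H|.+1); first by rewrite expn_gt0.
move=> G HG; have [G0|] := posnP #|G|.
  by rewrite /arcs big_pred0 // => x; have := card0_eq G0 x; rewrite !inE.
move=> G_gt0; rewrite leqNgt; apply/negP => /ltnW dense; apply/HG/model_minor.
apply: model_trans (dense_complete_model G_gt0 dense).
apply: subgraph_model.
have le : #|H| <= #|opt #|H| | by rewrite card_opt.
have finj : injective (fun h => enum_val (widen_ord le (enum_rank h)) : complete (opt #|H|)).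
  by move=> h h' /enum_val_inj/(congr1 val) /= /val_inj/enum_rank_inj.
exists (fun h => enum_val (widen_ord le (enum_rank h))) => // h h' hh'.
by apply: contraTneq hh' => /finj->; rewrite adj_irr.
Qed.

(** The nonempty classes in [S], joined when they touch, form a minor of [G], so they inherit the
    edge bound; empty classes touch nothing. *)
Lemma sparse_touch (C : nat) (H : sgraph) :
  (forall G : sgraph, ~ minor H G -> arcs G <= C * #|G|) ->
  forall (G : sgraph) (V : finType) (phi : G -> option V) (S : {set V}),
  ~ minor H G ->
  (forall k, conn (fib phi k)) ->
  \sum_(k in S) \sum_(l in S) (k != l) && touch phi k l <= C * #|S|.
Proof.
move=> CP G V phi S HG phiC.
pose S' := [set k in S | fib phi k != set0].
have -> : \sum_(k in S) \sum_(l in S) (k != l) && touch phi k l =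
          \sum_(k in S') \sum_(l in S') (k != l) && touch phi k l.
  have inS' k l : touch phi k l -> (k \in S) = (k \in S').
    move=> /touchP[x [_ [xk _ _]]]; rewrite inE; case: (k \in S) => //=.
    by apply/esym/set0Pn; exists x; rewrite inE xk.
  rewrite big_mkcond [RHS]big_mkcond; apply: eq_bigr => k _ /=.
  rewrite [\sum_(l in S) _]big_mkcond [\sum_(l in S') _]big_mkcond /=.
  have [/existsP[l kl]|] := boolP [exists l, touch phi k l]; last first.
    move=> /existsPn nk; rewrite !big1; first by rewrite !if_same.
      by move=> l _; rewrite (negbTE (nk l)) andbF if_same.
    by move=> l _; rewrite (negbTE (nk l)) andbF if_same.
  rewrite (inS' _ _ kl); case: (k \in S') => //; apply: eq_bigr => l' _.
  have [kl'|] := boolP (touch phi k l'); last by rewrite andbF !if_same.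
  by rewrite (inS' l' k) // touch_sym.
have leS : #|S'| <= #|S| by apply: subset_leq_card; apply/subsetP => k; rewrite inE => /andP[].
apply: leq_trans (leq_mul (leqnn C) leS).
pose qadj : rel {k | k \in S'} := fun k l => (val k != val l) && touch phi (val k) (val l).
have qsym : symmetric qadj by move=> k l; rewrite /qadj eq_sym touch_sym.
have qirr : irreflexive qadj by move=> k; rewrite /qadj eqxx.
pose Q := SGraph qsym qirr.
have -> : \sum_(k in S') \sum_(l in S') (k != l) && touch phi k l = arcs Q.
  rewrite /arcs -(sum_sig (fun k => k \in S') (fun k => \sum_(l in S') (k != l) && touch phi k l)).
  apply: eq_bigr => k _.
  by rewrite -(sum_sig (fun l => l \in S')
    (fun l => nat_of_bool ((val k != l) && touch phi (val k) l))).
have -> : #|S'| = #|Q| by rewrite card_sig; apply: eq_card => x; rewrite inE.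
apply: CP => /minor_model HQ; apply/HG/model_minor; apply: model_trans HQ _.
pose psi x : option Q := obind insub (phi x).
have psiE x (k : Q) : (psi x == Some k) = (phi x == Some (val k)).
  rewrite /psi; case: (phi x) => //= l; rewrite (inj_eq Some_inj).
  case: insubP => [l' _ <-|nl]; first by rewrite (inj_eq Some_inj) val_eqE.
  by apply/esym/negbTE; apply: contraNneq nl => ->; apply: valP.
have fibE (k : Q) : fib psi k = fib phi (val k).
  by apply/setP => x; rewrite !inE psiE.
exists psi; split.
- move=> k; have /set0Pn[x] : fib phi (val k) != set0.
    by have := valP k; rewrite inE => /andP[].
  by rewrite -fibE inE => /eqP; exists x.
- by move=> k; rewrite fibE.
- move=> k l /andP[_ /touchP[x [y [/eqP xk /eqP yl xy]]]].
  by apply/touchP; exists x, y; split=> //; apply/eqP; rewrite psiE.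
Qed.

End Sparsity.

(** * Clusterings of bounded size *)

Section Clusters.
Import mathcomp.boot.fintype mathcomp.boot.finset.
Local Open Scope set_scope.
Local Open Scope nat_scope.

Lemma exists_le_mean (T : finType) (S : {set T}) (f : T -> nat) C :
  S != set0 -> \sum_(x in S) f x <= C * #|S| -> exists2 x, x \in S & f x <= C.
Proof.
move=> /set0Pn[x0 x0S] le; apply: contrapT => no.
have : C.+1 * #|S| <= \sum_(x in S) f x.
  rewrite mulnC -sum_nat_const; apply: leq_sum => x xS.
  by rewrite ltnNge; apply/negP => fx; apply: no; exists x.
have : 0 < #|S| by apply/card_gt0P; exists x0.
move: le; lia.
Qed.

Lemma card_bigcup_le (I T : finType) (A : {set I}) (F : I -> {set T}) m :
  (forall i, i \in A -> #|F i| <= m) -> #|\bigcup_(i in A) F i| <= #|A| * m.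
Proof.
move=> Fm; rewrite -sum_nat_const; elim/big_rec2: _ => [|i n B iA le].
  by rewrite cards0.
apply: leq_trans (leq_add (Fm _ iA) le).
by rewrite cardsU leq_subr.
Qed.

Section Sparse.
Variables (V : finType) (r : rel V) (C : nat).
Hypothesis r_sparse : forall S : {set V},
  \sum_(k in S) \sum_(l in S) (k != l) && r k l <= C * #|S|.

Definition cliqueb (T : {set V}) := [forall x in T, forall y in T, (x != y) ==> r x y].

Lemma cliqueP (T : {set V}) :
  reflect {in T &, forall x y, x != y -> r x y} (cliqueb T).
Proof.
apply: (iffP forall_inP) => [h x y xT yT xy|h x xT].
  by have /forall_inP/(_ y yT)/implyP/(_ xy) := h x xT.
by apply/forall_inP => y yT; apply/implyP; apply: h.
Qed.

Lemma card_clique (T : {set V}) : cliqueb T -> #|T| <= C.+1.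
Proof.
move=> /cliqueP Tc; have [->|T0] := eqVneq T set0; first by rewrite cards0.
have [x xT] := exists_le_mean T0 (r_sparse T).
rewrite (bigD1 x) //= eqxx add0n => le; rewrite (cardsD1 x) xT add1n ltnS.
apply: leq_trans le; rewrite -sum1_card big_mkcond [leqRHS]big_mkcond.
apply: leq_sum => y _; rewrite !inE andbC.
case: (boolP (y \in T)) => //= yT; case: (eqVneq y x) => //= yx.
by rewrite Tc // eq_sym.
Qed.

(** Degeneracy: some [x] has at most [C] neighbours in [A], and a clique through [x] is determined
    by a subset of them. Remove [x] and induct; the 1 accounts for the empty clique. *)
Lemma card_cliques (A : {set V}) :
  #|[set T : {set V} | (T \subset A) && cliqueb T]| <= 1 + 2 ^ C * #|A|.
Proof.
have [n] := ubnP #|A|; elim: n A => // n IH A leA.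
have [->|A0] := eqVneq A set0.
  rewrite cards0 muln0 addn0 -(cards1 (set0 : {set V})); apply: subset_leq_card.
  by apply/subsetP => T; rewrite !inE subset0 => /andP[].
have [x xA low] := exists_le_mean A0 (r_sparse A).
pose A' := A :\ x; have cA : #|A| = #|A'|.+1 by rewrite (cardsD1 x) xA.
have lA' : #|A'| < n by rewrite -ltnS -cA.
pose N := [set y in A' | r x y].
have cN : #|N| <= C.
  apply: leq_trans low; rewrite -sum1_card big_mkcond [leqRHS]big_mkcond.
  apply: leq_sum => y _; rewrite !inE [x == y]eq_sym.
  by case: (y \in A); case: (y == x); case: (r x y).
pose Q := [set T : {set V} | [&& T \subset A, cliqueb T & x \in T]].
have cQ : #|Q| <= 2 ^ C.
  apply: (@leq_trans #|powerset N|); last by rewrite card_powerset leq_pexp2l.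
  have inj : {in Q &, injective (fun T => T :\ x)}.
    move=> T T'; rewrite !inE => /and3P[_ _ xT] /and3P[_ _ xT'] E.
    by rewrite -(setD1K xT) -(setD1K xT') E.
  rewrite -(card_in_imset inj); apply: subset_leq_card.
  apply/subsetP => _ /imsetP[T + ->]; rewrite inE => /and3P[TA /cliqueP Tc xT].
  rewrite powersetE; apply/subsetP => y; rewrite !inE => /andP[yx yT].
  by rewrite yx (subsetP TA) // Tc // eq_sym.
apply: (@leq_trans #|[set T : {set V} | (T \subset A') && cliqueb T] :|: Q|).
  apply: subset_leq_card; apply/subsetP => T; rewrite !inE => /andP[TA Tc].
  rewrite TA Tc /= andbT; case: (boolP (x \in T)) => xT; rewrite ?orbT // orbF.
  apply/subsetP => y yT; rewrite !inE (subsetP TA) // andbT.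
  by apply: contraNneq xT => <-.
rewrite cardsU; apply: leq_trans (leq_subr _ _) _.
by rewrite cA mulnS; have := IH _ lA'; move: cQ; lia.
Qed.

End Sparse.

(* Removing vertices of low degree one at a time, each removed vertex points to
   a heaviest edge at it; this yields a two-colourable pointer forest. *)
Lemma heavy_forest (V : finType) (w : V -> V -> nat) (C : nat) (S : {set V}) :
  (forall x y, w x y = w y x) ->
  (forall S : {set V},
    \sum_(x in S) \sum_(y in S) (x != y) && (0 < w x y) <= C * #|S|) ->
  exists (p : V -> V) (chi : V -> bool),
    [/\ {in S, forall x, p x \in S},
        {in S, forall x, p x != x -> chi (p x) != chi x /\ 0 < w x (p x)} &
        \sum_(x in S) \sum_(y in S) (x != y) * w x y <=
        2 * C * \sum_(x in S) (p x != x) * w x (p x)].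
Proof.
move=> wC sp; have [n] := ubnP #|S|; elim: n S => // n IH S leS.
have [->|S0] := eqVneq S set0.
  exists id, xpredT; split=> [x|x|]; rewrite ?inE //.
  by rewrite !big_set0.
have [x xS low] := exists_le_mean S0 (sp S).
pose S' := S :\ x; have cS : #|S| = #|S'|.+1 by rewrite (cardsD1 x) xS.
have lS' : #|S'| < n by rewrite -ltnS -cS.
have [p [chi [pS' pchi le]]] := IH S' lS'.
(* The pointer of [x] goes to a heaviest neighbour, which carries at least a [1/C] share of the
   weight at [x] as there are at most [C] neighbours. An isolated [x] points to itself. *)
have [u uP leu] : exists2 u, u = x \/ u \in S' /\ 0 < w x u &
    \sum_(y in S') w x y <= C * ((u != x) * w x u).
  have [/existsP[y0 /andP[y0S y0w]]|] :=
      boolP [exists y, (y \in S') && (0 < w x y)]; last first.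
    move=> /existsPn no; exists x; first by left.
    rewrite big1 // => y yS; have := no y; rewrite yS /=.
    by case: (w x y).
  case: (@arg_maxnP _ y0 [pred y | y \in S'] (w x)) => //= u uS umax.
  have u0 : 0 < w x u by apply: leq_trans y0w (umax _ y0S).
  exists u; first by right.
  have -> : u != x by move: uS; rewrite !inE => /andP[].
  rewrite mul1n; apply: leq_trans (leq_mul low (leqnn _)).
  rewrite big_distrl /= big_mkcond [leqRHS]big_mkcond; apply: leq_sum => y _.
  rewrite !inE; case: (eqVneq y x) => //= yx; case: (boolP (y \in S)) => // yS.
  case: posnP => [->//|_]; rewrite mul1n umax //.
  by rewrite !inE yx.
have S'S y : y \in S' -> (y \in S) * (y != x) by rewrite !inE => /andP[-> ->].
have pNx y : y \in S' -> p y != x by move/pS'/S'S => ->.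
exists (fun y => if y == x then u else p y),
       (fun y => if y == x then ~~ chi u else chi y); split.
- move=> y yS; case: (eqVneq y x) => [_|yx].
    by case: uP => [->|[/S'S->]].
  by rewrite (S'S (p y)) // pS' // !inE yx.
- move=> y yS; case: (eqVneq y x) => [->|yx].
    case: uP => [->|[/S'S uS uw] ux]; first by rewrite eqxx.
    by rewrite (negbTE ux); case: (chi u).
  have yS' : y \in S' by rewrite !inE yx.
  by rewrite (negbTE (pNx _ yS')); apply: pchi.
have splitS (F : V -> nat) : \sum_(y in S) F y = F x + \sum_(y in S') F y.
  rewrite (bigD1 x) //=; congr (_ + _); apply: eq_bigl => y.
  by rewrite !inE andbC.
have -> : \sum_(y in S) \sum_(z in S) (y != z) * w y z =
    2 * \sum_(y in S') w x y + \sum_(y in S') \sum_(z in S') (y != z) * w y z.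
  rewrite splitS splitS eqxx mul0n add0n.
  under [X in _ + X]eq_bigr => y _ do rewrite splitS.
  rewrite big_split /= mul2n -addnn -!addnA; congr (_ + _).
    by apply: eq_bigr => y /S'S yS; rewrite eq_sym yS mul1n.
  congr (_ + _); apply: eq_bigr => y /S'S yS; by rewrite yS mul1n wC.
rewrite splitS eqxx.
have -> : \sum_(y in S') ((if y == x then u else p y) != y) *
    w y (if y == x then u else p y) = \sum_(y in S') (p y != y) * w y (p y).
  by apply: eq_bigr => y /S'S yS; rewrite (negbTE yS.2).
rewrite mulnDr leq_add // -mulnA leq_mul2l /=; exact: leu.
Qed.

(** Keeping only the pointers that leave one colour class turns the forest into stars, since the
    targets then become fixed points. The better class keeps half the weight, whence 4 in place of
    2. *)
Lemma heavy_stars (V : finType) (w : V -> V -> nat) (C : nat) :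
  (forall x y, w x y = w y x) ->
  (forall S : {set V},
    \sum_(x in S) \sum_(y in S) (x != y) && (0 < w x y) <= C * #|S|) ->
  exists p : V -> V,
    [/\ forall x, p (p x) = p x,
        forall x, p x != x -> 0 < w x (p x) &
        \sum_x \sum_y (x != y) * w x y <=
        4 * C * \sum_x (p x != x) * w x (p x)].
Proof.
move=> wC sp; have [p [chi [_ pchi le]]] := heavy_forest [set: V] wC sp.
pose s b := \sum_(x | chi x == b) (p x != x) * w x (p x).
have sE : \sum_(x in [set: V]) (p x != x) * w x (p x) = s true + s false.
  rewrite (eq_bigl xpredT) => [|x]; last by rewrite inE.
  by rewrite (bigID chi) /=; congr (_ + _); apply: eq_bigl => x; case: (chi x).
have [b sb] : exists b, s true + s false <= 2 * s b.
  by case: (leqP (s true) (s false)) => h; [exists false|exists true]; lia.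
pose p' x := if chi x == b then p x else x; exists p'; split.
- move=> x; rewrite /p'; case: (eqVneq (chi x) b) => [xb|xb]; last first.
    by rewrite (negbTE xb).
  case: (eqVneq (p x) x) => [E|px]; first by rewrite !E xb eqxx.
  have [pc _] := pchi x (in_setT x) px; rewrite xb in pc.
  by rewrite (negbTE pc).
- move=> x; rewrite /p'; case: ifP => _; last by rewrite eqxx.
  by move=> px; have [] := pchi x (in_setT x) px.
have -> : \sum_x \sum_y (x != y) * w x y =
    \sum_(x in [set: V]) \sum_(y in [set: V]) (x != y) * w x y.
  by apply: eq_big => [x|x _]; rewrite ?inE //; apply: eq_bigl => y; rewrite inE.
apply: leq_trans le _; rewrite sE.
have -> : \sum_x (p' x != x) * w x (p' x) = s b.
  rewrite [RHS]big_mkcond; apply: eq_bigr => x _; rewrite /p'.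
  by case: ifP => // _; rewrite eqxx.
by rewrite [4 * C](_ : _ = 2 * C * 2) -?mulnA ?leq_mul2l ?sb ?orbT //; lia.
Qed.

Section Clustering.
Variables (H : sgraph) (C : nat).
Hypothesis C_gt0 : 0 < C.
Hypothesis H_sparse : forall G : sgraph, ~ minor H G -> arcs G <= C * #|G|.

(** Clusters partition [L] and are named by vertices of [G]; a name need not lie in its cluster. *)
Definition label (G : sgraph) (L : {set G}) (c : G -> G) (x : G) : option G :=
  if x \in L then Some (c x) else None.

Lemma label_fib (G : sgraph) (L : {set G}) (c : G -> G) k x :
  (x \in fib (label L c) k) = (x \in L) && (c x == k).
Proof. by rewrite inE /label; case: (x \in L). Qed.

Definition cross (G : sgraph) (L : {set G}) (c : G -> G) :=
  \sum_(x in L) \sum_(y in L) (c x != c y) * adj x y.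

Definition degree (G : sgraph) (x : G) := \sum_(y : G) (adj x y : nat).

Lemma degree_card (G : sgraph) (x : G) : degree x = #|[set y | adj x y]|.
Proof. by rewrite /degree (sum_bool_card xpredT). Qed.

(** Heavy stars in the quotient carry a [1/(4C)] share of the crossing edges, and merging each star
    makes these internal. A star stays small: its hub has at most [s] vertices, each with at most
    [D] neighbours, each in a cluster of size at most [s]. *)
Lemma merge_clusters (G : sgraph) (L : {set G}) (c : G -> G) s D :
  ~ minor H G -> {in L, forall x, degree x <= D} ->
  (forall k, conn (fib (label L c) k)) ->
  (forall k, #|fib (label L c) k| <= s) ->
  exists c' : G -> G,
    [/\ forall k, conn (fib (label L c') k),
        forall k, #|fib (label L c') k| <= s + s * (D * s) &
        4 * C * cross L c' + cross L c <= 4 * C * cross L c].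
Proof.
move=> HG degL cC cs.
pose w k l := \sum_(x in fib (label L c) k) \sum_(y in fib (label L c) l) (adj x y : nat).
have wC k l : w k l = w l k.
  by rewrite /w exchange_big; apply: eq_bigr => x _; apply: eq_bigr => y _; rewrite adj_sym.
have w_touch k l : 0 < w k l -> exists x y,
    [/\ x \in fib (label L c) k, y \in fib (label L c) l & adj x y].
  move=> w0; apply: contrapT => no; move: w0; rewrite /w big1 // => x xk.
  rewrite big1 // => y yl; case xy: (adj x y) => //; case: no; by exists x, y.
have sum_labels (g : G -> G -> nat) :
    \sum_(x in L) \sum_(y in L) g (c x) (c y) * adj x y =
    \sum_k \sum_l g k l * w k l.
  rewrite (partition_big c predT) //=; apply: eq_bigr => k _.
  transitivity (\sum_(x in fib (label L c) k) \sum_l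
      \sum_(y in fib (label L c) l) g k l * adj x y).
    apply: eq_big => [x|x /andP[xL /eqP xk]]; first by rewrite label_fib.
    rewrite (partition_big c predT) //=; apply: eq_bigr => l _.
    by apply: eq_big => [y|y /andP[_ /eqP->]]; rewrite ?label_fib ?xk.
  rewrite exchange_big; apply: eq_bigr => l _; rewrite big_distrr /=.
  by apply: eq_bigr => x _; rewrite big_distrr.
have [p [pp pw leW]] : exists p : G -> G, [/\ forall x, p (p x) = p x,
    forall x, p x != x -> 0 < w x (p x) &
    \sum_x \sum_y (x != y) * w x y <= 4 * C * \sum_x (p x != x) * w x (p x)].
  apply: heavy_stars => // S.
  apply: leq_trans (sparse_touch H_sparse S HG cC).
  apply: leq_sum => k _; apply: leq_sum => l _.
  case: (k != l) => //=; case: (posnP (w k l)) => // /w_touch[x [y []]].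
  rewrite !inE => /eqP xk /eqP yl xy.
  suff -> : touch (label L c) k l by [].
  by apply/touchP; exists x, y.
have sub k : fib (label L c) k \subset fib (label L (p \o c)) (p k).
  by apply/subsetP => x; rewrite !label_fib /= => /andP[-> /eqP->]/=.
have hub k x : x \in fib (label L (p \o c)) k -> exists2 y, y \in fib (label L c) k &
    connect (adj_in (fib (label L (p \o c)) k)) x y.
  rewrite label_fib /= => /andP[xL /eqP xk].
  have [cxk|cxk] := eqVneq (p (c x)) (c x).
    by exists x; rewrite ?connect0 // label_fib xL -cxk xk eqxx.
  have [z [y [zc yk zy]]] := w_touch _ _ (pw _ cxk).
  rewrite xk in yk; exists y => //.
  have subc := sub (c x); rewrite xk in subc.
  have subk := sub k; rewrite -{2}xk pp xk in subk.
  apply: (@connect_trans _ _ z).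
    by apply: (adj_in_sub subc); apply: cC => //; rewrite label_fib xL eqxx.
  by apply: connect1; rewrite adj_inE zy (subsetP subc) // (subsetP subk).
exists (p \o c); split.
- move=> k x y /[dup] xk /hub[x' x'k xx'] /hub[y' y'k yy'].
  have subk : fib (label L c) k \subset fib (label L (p \o c)) k.
    have := sub k; move: xk; rewrite label_fib /= => /andP[_ /eqP cxk].
    by have -> : p k = k by rewrite -cxk pp.
  apply: connect_trans xx' _; rewrite adj_in_sym; apply: connect_trans yy' _.
  by apply: (adj_in_sub subk); apply: cC.
- move=> k; set F := fib (label L c) k.
  apply: (@leq_trans
    #|F :|: \bigcup_(x in F) \bigcup_(y in [set y | adj x y]) fib (label L c) (c y)|).
    apply: subset_leq_card; apply/subsetP => x; rewrite label_fib /= => /andP[xL /eqP xk].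
    rewrite inE; have [cxk|cxk] := eqVneq (p (c x)) (c x).
      by rewrite label_fib xL -cxk xk eqxx.
    have [z [y [zc yk zy]]] := w_touch _ _ (pw _ cxk).
    apply/orP; right; apply/bigcupP; exists y; first by rewrite /F -xk.
    apply/bigcupP; exists z; first by rewrite inE adj_sym.
    move: zc; rewrite !label_fib => /andP[_ /eqP->].
    by rewrite xL eqxx.
  rewrite cardsU; apply: leq_trans (leq_subr _ _) _; apply: leq_add; first exact: cs.
  apply: (@leq_trans (#|F| * (D * s))); last by rewrite leq_mul2r cs orbT.
  apply: card_bigcup_le => x; rewrite label_fib => /andP[xL _].
  apply: leq_trans (card_bigcup_le _) _; first by move=> y _; apply: cs.
  by rewrite -degree_card leq_mul2r degL ?orbT.
rewrite /cross (sum_labels (fun k l => nat_of_bool (k != l))).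
rewrite (sum_labels (fun k l => nat_of_bool (p k != p l))).
apply: leq_trans (leq_add (leqnn _) leW) _; rewrite -mulnDr leq_mul2l.
apply/orP; right; rewrite -big_split /=; apply: leq_sum => k _.
(* For the cluster [k], the term at [p k] is the weight gained on the left and vanishes from the new
   crossing sum; no other term increases. *)
rewrite (bigD1 (p k)) //= [leqRHS](bigD1 (p k)) //= pp eqxx mul0n add0n addnC.
rewrite [k == _]eq_sym leq_add2l; apply: leq_sum => l _.
rewrite leq_mul2r; apply/orP; right.
by case: (eqVneq k l) => [->|_]; rewrite ?eqxx // leq_b1.
Qed.

(** Bernoulli's inequality for [K / K.-1], with denominators cleared. *)
Lemma expn_pred_ge K j : 0 < K.-1 -> K.-1 ^ j * (K.-1 + j) <= K ^ j * K.-1.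
Proof.
move=> K1; elim: j => [|j IH]; first by rewrite !expn0 addn0.
rewrite !expnS; have step : K.-1 * (K.-1 + j.+1) <= (K.-1 + j) * K by lia.
have := leq_mul (leqnn (K.-1 ^ j)) step; have := leq_mul (leqnn K) IH.
move: (K.-1 ^ j) (K ^ j) (K.-1) => X Y Z; nia.
Qed.

(* Iterating [merge_clusters] multiplies the number of edges between clusters by
   a constant less than 1, while cluster sizes stay bounded in terms of [D]. *)
Lemma hyperfinite (D q : nat) : exists s, forall (G : sgraph) (L : {set G}),
  ~ minor H G -> {in L, forall x, degree x <= D} ->
  exists c : G -> G,
    [/\ forall k, conn (fib (label L c) k),
        forall k, #|fib (label L c) k| <= s &
        q * cross L c <= #|L|].
Proof.
set K := 4 * C.
have iter j : exists s, forall (G : sgraph) (L : {set G}),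
    ~ minor H G -> {in L, forall x, degree x <= D} ->
    exists c : G -> G,
    [/\ forall k, conn (fib (label L c) k),
        forall k, #|fib (label L c) k| <= s &
        K ^ j * cross L c <= K.-1 ^ j * (D * #|L|)].
  elim: j => [|j [s IH]].
    exists 1 => G L _ degL; exists id.
    have fib1 k : fib (label L id) k \subset [set k].
      by apply/subsetP => x; rewrite label_fib inE => /andP[].
    split=> [k x y|k|].
    - move=> /[dup] xk /(subsetP (fib1 _)); rewrite inE => /eqP->.
      by move=> /(subsetP (fib1 _)); rewrite inE => /eqP->; apply: connect0.
    - by rewrite -(cards1 k) subset_leq_card.
    rewrite !expn0 !mul1n mulnC -sum_nat_const; apply: leq_sum => x xL.
    apply: leq_trans (degL _ xL); rewrite [leqLHS]big_mkcond; apply: leq_sum => y _.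
    by case: (y \in L) => //; case: (x != y); rewrite ?mul1n ?mul0n.
  exists (s + s * (D * s)) => G L HG degL; have [c [cC cs le]] := IH G L HG degL.
  have [c' [c'C c's le']] := merge_clusters HG degL cC cs.
  exists c'; split=> //; rewrite !expnS -[K.-1 * _ * _]mulnA.
  apply: leq_trans (leq_mul (leqnn _) le).
  rewrite [leqRHS]mulnCA [K * _]mulnC -mulnA leq_mul2l; apply/orP; right.
  by move: le'; rewrite -/K -subn1 mulnBl mul1n; lia.
(* By Bernoulli, this many rounds shrink the initial bound [D * #|L|] by a factor of at least
   [1 + q * D]. *)
have [s sP] := iter (q * D * K.-1); exists s => G L HG degL.
have [c [cC cs le]] := sP G L HG degL; exists c; split=> //.
have K1 : 0 < K.-1 by rewrite /K; case: C C_gt0 => // n _; lia.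
move: le; have := expn_pred_ge (q * D * K.-1) K1.
have -> : K.-1 + q * D * K.-1 = (1 + q * D) * K.-1 by lia.
rewrite mulnA leq_mul2r eqn0Ngt K1 /=.
move: (K ^ _) (expn_gt0 K (q * D * K.-1)) => X X0.
move: (K.-1 ^ _) (expn_gt0 K.-1 (q * D * K.-1)) => Y Y0 leXY le.
rewrite K1 /= in Y0.
have {X0} X0 : 0 < X by nia.
have : Y * (q * (X * cross L c)) <= Y * (X * #|L|).
  apply: (@leq_trans (Y * (q * (Y * (D * #|L|))))); first by rewrite !leq_mul2l le !orbT.
  by rewrite leq_mul2l; apply/orP; right; nia.
rewrite leq_mul2l eqn0Ngt Y0 /= mulnCA leq_mul2l eqn0Ngt X0 //=.
Qed.

Definition nbrs (G : sgraph) (A L : {set G}) (c : G -> G) (k : G) : {set G} :=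
  [set a in A | [exists x, (x \in fib (label L c) k) && adj x a]].

(* Greedily contract a cluster into one of its neighbours in [A] as long as this
   creates a new edge of the minor induced on [A]; sparsity bounds the number of
   steps, and the remaining clusters have cliques as neighbourhoods. *)
Lemma clique_nbrs (G : sgraph) (A L : {set G}) (c : G -> G) :
  ~ minor H G -> [disjoint A & L] -> (forall k, conn (fib (label L c) k)) ->
  exists (B : {set G}) (r : rel G),
    [/\ #|B| <= C * #|A|,
        forall S : {set G}, \sum_(k in S) \sum_(l in S) (k != l) && r k l <= C * #|S| &
        forall k, k \notin B -> cliqueb r (nbrs A L c k)].
Proof.
move=> HG dAL cC.
have AL x : x \in A -> x \in L = false by move=> xA; rewrite (disjointFr dAL).
(* The map [g] records the contractions: cluster [k] is absorbed by the vertex [g k] of [A], or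
   dropped. *)
pose phi (g : {ffun G -> option G}) (x : G) : option G :=
  if x \in A then Some x else if x \in L then g (c x) else None.
pose valid (g : {ffun G -> option G}) :=
  [forall k, if g k is Some a then a \in nbrs A L c k else true].
have validP g k a : valid g -> g k = Some a -> a \in nbrs A L c k.
  by move=> /forallP/(_ k); case: (g k) => // b + [<-].
have phiC g : valid g -> forall a, conn (fib (phi g) a).
  move=> vg a.
  have to_a x : x \in fib (phi g) a -> connect (adj_in (fib (phi g) a)) x a.
    rewrite inE /phi; case: ifP => [_ /eqP[->]|xA]; first exact: connect0.
    case: ifP => // xL /eqP gx.
    have := validP _ _ _ vg gx; rewrite inE => /andP[aA /existsP[y /andP[yx ya]]].
    have sub : fib (label L c) (c x) \subset fib (phi g) a.
      apply/subsetP => z; rewrite label_fib => /andP[zL /eqP zx].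
      by rewrite inE /phi zL zx gx; case: ifP => [/AL|//]; rewrite zL.
    apply: (@connect_trans _ _ y).
      by apply: (adj_in_sub sub); apply: cC; rewrite ?yx // label_fib xL eqxx.
    by apply: connect1; rewrite adj_inE ya (subsetP sub) // inE /phi aA eqxx.
  move=> x y /to_a xa /to_a ya; apply: connect_trans xa _.
  by rewrite adj_in_sym.
pose darts g := [set e : G * G | [&& e.1 \in A, e.2 \in A, e.1 != e.2 & touch (phi g) e.1 e.2]].
(* The greedy process is replaced by maximality: among maps assigning no more clusters than there
   are darts, take one assigning the most. *)
pose good g := valid g && (#|[set k | isSome (g k)]| <= #|darts g|).
have good0 : good [ffun=> None].
  apply/andP; split; first by apply/forallP => k; rewrite ffunE.
  by rewrite (eq_card0 (A := [set k | _])) // => k; rewrite !inE ffunE.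
case: (@arg_maxnP _ [ffun=> None] good (fun g => #|[set k | isSome (g k)]|)) => //.
move=> g /andP[vg le] gmax.
have sp S := sparse_touch H_sparse S HG (phiC g vg).
exists [set k | isSome (g k)], (touch (phi g)); split=> //.
- apply: leq_trans le _; apply: leq_trans (sp A).
  rewrite pair_big /= (sum_bool_card _ (fun e : G * G => (e.1 != e.2) && touch (phi g) e.1 e.2)).
  by apply: subset_leq_card; apply/subsetP => e; rewrite !inE -andbA.
move=> k; rewrite inE => gk; apply/cliqueP => a b ak bk ab.
apply: contraT => nab.
pose g' : {ffun G -> option G} := [ffun l => if l == k then Some a else g l].
have vg' : valid g'.
  apply/forallP => l; rewrite ffunE; case: (eqVneq l k) => [->//|_].
  by have /forallP := vg.
have phi_sub x l : phi g x = Some l -> phi g' x = Some l.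
  rewrite /phi; case: ifP => // _; case: ifP => // _; rewrite ffunE.
  by case: eqP => // ->; case: (g k) gk.
have /and3P[aA bA _] : [&& a \in A, b \in A & true].
  by move: ak bk; rewrite !inE => /andP[-> _] /andP[-> _].
(* Absorbing [k] into [a] keeps all darts and adds [(a, b)], because the cluster has an edge to [b];
   so [g'] is a larger good map. *)
have dd : #|darts g| < #|darts g'|.
  apply: proper_card; apply/properP; split.
    apply/subsetP => -[x y]; rewrite !inE /= => /and4P[-> -> -> /touchP[u [v [ux vy uv]]]] /=.
    by apply/touchP; exists u, v; rewrite !(phi_sub _ _ ux, phi_sub _ _ vy).
  exists (a, b); rewrite inE /= aA bA ab ?(negbTE nab) //=.
  move: bk; rewrite inE => /andP[_ /existsP[y /andP[]]].
  rewrite label_fib => /andP[yL /eqP yk] yb.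
  apply/touchP; exists y, b; rewrite /phi yL yk ffunE eqxx bA; split=> //.
  by case: ifP => // /AL; rewrite yL.
have cc : #|[set l | isSome (g' l)]| = #|[set l | isSome (g l)]|.+1.
  rewrite (cardsD1 k) inE ffunE eqxx /= add1n; congr _.+1; apply: eq_card => l.
  by rewrite !inE ffunE; case: (eqVneq l k) => [->|]//=; rewrite (negbTE gk).
have /gmax : good g' by rewrite /good vg' cc (leq_ltn_trans le dd).
by rewrite /= cc ltnn.
Qed.

End Clustering.

End Clusters.

(** * Fans *)

Section Fans.
Import mathcomp.boot.fintype mathcomp.boot.finset.
Local Open Scope set_scope.
Local Open Scope nat_scope.

Section Fan.
Variables (P : sgraph) (T : finType) (F : P -> T -> bool) (I : finType).

Definition fan_adj : rel (T + P * I)%type := fun x y =>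
  match x, y with
  | inl _, inl _ => false
  | inl t, inr (p, _) => F p t
  | inr (p, _), inl t => F p t
  | inr (p, i), inr (p', i') => (i == i') && adj p p'
  end.

Lemma fan_sym : symmetric fan_adj.
Proof. by move=> [t|[p i]] [t'|[p' i']] //=; rewrite eq_sym adj_sym. Qed.

Lemma fan_irr : irreflexive fan_adj.
Proof. by move=> [t|[p i]] //=; rewrite adj_irr andbF. Qed.

Definition fan : sgraph := SGraph fan_sym fan_irr.

(** The arcs added by each copy of [P]; large fans have density close to this divided by
    [2 * #|P|]. *)
Definition fan_weight : nat := arcs P + 2 * \sum_p \sum_t (F p t : nat).

Lemma card_fan : #|fan| = #|T| + #|P| * #|I|.
Proof. by rewrite card_sum card_prod. Qed.

Lemma arcs_fan : arcs fan = #|I| * fan_weight.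
Proof.
have E (x : fan) : \sum_(y : fan) (adj x y : nat) =
    \sum_t (fan_adj x (inl t) : nat) + \sum_p \sum_i (fan_adj x (inr (p, i)) : nat).
  rewrite [LHS](big_sumType _ xpredT) /=; congr (_ + _).
  by rewrite pair_bigA; apply: eq_bigr => -[].
rewrite /arcs; under eq_bigr do rewrite E.
rewrite [LHS](big_sumType _ xpredT) /= (eq_bigr (fun t => #|I| * \sum_p (F p t : nat))); last first.
  move=> t _; rewrite big1 // add0n big_distrr /=; apply: eq_bigr => p _.
  by rewrite sum_nat_const.
rewrite -big_distrr exchange_big /=.
rewrite (eq_bigr (fun e : P * I => \sum_t (F e.1 t : nat) + \sum_p (adj e.1 p : nat))); last first.
  move=> [p i] _ /=; congr (_ + _); apply: eq_bigr => p' _.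
  rewrite (bigD1 i) //= eqxx big1 ?addn0 // => j ji.
  by rewrite eq_sym (negbTE ji).
rewrite -(pair_bigA _ (fun p (i : I) => \sum_t (F p t : nat) + \sum_p' (adj p p' : nat))) /=.
rewrite [X in _ + X](eq_bigr (fun p =>
    #|I| * (\sum_t (F p t : nat) + \sum_p' (adj p p' : nat)))); last first.
  by move=> p _; rewrite sum_nat_const.
rewrite -big_distrr big_split /= /fan_weight /arcs mul2n -addnn !mulnDr.
by rewrite addnA addnC.
Qed.

End Fan.

Lemma fan_subgraph (P : sgraph) (T : finType) (F : P -> T -> bool)
    (I J : finType) : #|I| <= #|J| -> subgraph (fan F I) (fan F J).
Proof.
move=> IJ; pose f (i : I) : J := enum_val (widen_ord IJ (enum_rank i)).
have finj : injective f by move=> i i' /enum_val_inj/(congr1 val) /= /val_inj/enum_rank_inj.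
exists (fun x : fan F I => match x with inl t => inl t | inr (p, i) => inr (p, f i) end).
  by move=> [t|[p i]] [t'|[p' i']] //; [move=> [->]|move=> [-> /finj->]].
by move=> [t|[p i]] [t'|[p' i']] //= /andP[/eqP-> ->]; rewrite eqxx.
Qed.

(** If each [x] failed at some [m], the maximum of these finitely many [m] would have no witness.
    This later selects one cluster pattern good for every number of copies. *)
Lemma pigeonhole_all (X : finType) (Q : X -> nat -> Prop) :
  (forall x m m', m <= m' -> Q x m' -> Q x m) ->
  (forall m, exists x, Q x m) -> exists x, forall m, Q x m.
Proof.
move=> mono ex; apply: contrapT => no.
have /choice[f fP] : forall x, exists m, ~ Q x m.
  move=> x; apply: contrapT => h; apply: no; exists x => m.
  by apply: contrapT => q; apply: h; exists m.
have [x Qx] := ex (\max_x f x); apply: (fP x); apply: mono Qx.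
exact: leq_bigmax.
Qed.

(* Only boundedly many disjoint degree ranges can carry a positive proportion of
   all edges, so some threshold [D] has negligible degree mass just above it, up
   to an arbitrary [D']. *)
Lemma degree_gap (Cl : sgraph -> Prop) C q :
  (forall G, Cl G -> arcs G <= C * #|G|) ->
  (forall N, exists2 G, Cl G & N <= #|G|) ->
  exists D, forall D' N, exists G, [/\ Cl G, N <= #|G| &
    q * \sum_(x : G | D < degree x <= D') degree x <= #|G| ].
Proof.
move=> ClC ClN; apply: contrapT => no.
have gap D : exists D' N, forall G, Cl G -> N <= #|G| ->
    #|G| < q * \sum_(x : G | D < degree x <= D') degree x.
  apply: contrapT => h; apply: no; exists D => D' N; apply: contrapT => h'.
  apply: h; exists D', N => G GC GN; rewrite ltnNge; apply/negP => le.
  by apply: h'; exists G.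
(* If every threshold fails, successive disjoint ranges each contribute more than [#|G| / q];
   [j = q * C + 1] of them exceed the total degree. *)
have claim j : exists D N, forall G, Cl G -> N <= #|G| ->
    j * #|G| <= q * \sum_(x : G | degree x <= D) degree x.
  elim: j => [|j [D [N IH]]]; first by exists 0, 0.
  have [D' [N' gapD]] := gap D; exists (maxn D D'), (maxn N N') => G GC.
  rewrite geq_max => /andP[/(IH G GC) le1 /(gapD G GC) lt2].
  apply: (@leq_trans (q * (\sum_(x : G | degree x <= D) degree x +
      \sum_(x : G | D < degree x <= D') degree x))); first by lia.
  rewrite leq_mul2l; apply/orP; right.
  rewrite [X in X + _]big_mkcond [X in _ + X]big_mkcond [leqRHS]big_mkcond.
  rewrite -big_split /=; apply: leq_sum => x _; rewrite leq_max.
  by case: (leqP (degree x) D) => _ //=; rewrite ?addn0 //; case: ifP.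
have [D [N h]] := claim (q * C).+1.
have [G GC] := ClN (maxn N 1); rewrite geq_max => /andP[/(h G GC) le n1].
have : q * \sum_(x : G | degree x <= D) degree x <= q * (C * #|G|).
  rewrite leq_mul2l; apply/orP; right; apply: leq_trans (ClC _ GC).
  by rewrite big_mkcond; apply: leq_sum => x _; case: ifP.
by move: le n1; nia.
Qed.

Section Pieces.
Variables (H : sgraph) (C : nat).
Hypothesis C_gt0 : 0 < C.
Hypothesis H_sparse : forall G : sgraph, ~ minor H G -> arcs G <= C * #|G|.

(** The sizes of a cluster and of its neighbourhood, the adjacency matrix of the cluster, and its
    incidence with the neighbourhood. The type is finite, as the pigeonhole arguments require. *)
Definition piece_code s t : finType :=
  ('I_s.+1 * 'I_t.+1 * {ffun 'I_s.+1 * 'I_s.+1 -> bool}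
    * {ffun 'I_s.+1 * 'I_t.+1 -> bool})%type.

(* Entries beyond the sizes of [K] and [N] are junk, determined by [x0]. *)
Definition encode (G : sgraph) s t (x0 : G) (K N : {set G}) : piece_code s t :=
  (inord #|K|, inord #|N|,
   [ffun e : 'I_s.+1 * 'I_s.+1 => adj (nth x0 (enum K) (e.1 : nat)) (nth x0 (enum K) (e.2 : nat))],
   [ffun e : 'I_s.+1 * 'I_t.+1 => adj (nth x0 (enum K) (e.1 : nat)) (nth x0 (enum N) (e.2 : nat))]).

Definition piece_weight (G : sgraph) (K N : {set G}) : nat :=
  \sum_(x in K) \sum_(y in K) (adj x y : nat) +
  2 * \sum_(x in K) \sum_(a in N) (adj x a : nat).

(** Here [U] names the clusters that occur in at least [m] copies with the same code and the same
    neighbours. The bound [s] is fixed before [m], so the set of codes does not grow with the number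
    of copies asked for. *)
Lemma many_pieces D q : exists s, forall m, exists D' N, forall G : sgraph,
  ~ minor H G -> N <= #|G| ->
  q * \sum_(x : G | D < degree x <= D') degree x <= #|G| ->
  exists (A L : {set G}) (c : G -> G) (U : {set G}),
  [/\ [disjoint A & L],
      forall k, conn (fib (label L c) k),
      forall k, #|fib (label L c) k| <= s,
      {in U, forall k, [/\ fib (label L c) k != set0,
         #|nbrs A L c k| <= C.+1 &
         m <= #|[set k' | (nbrs A L c k' == nbrs A L c k) &&
           (encode s C.+1 k' (fib (label L c) k') (nbrs A L c k') ==
            encode s C.+1 k (fib (label L c) k) (nbrs A L c k))] | ]} &
      q * arcs G <= 6 * #|G| +
        q * \sum_(k in U) piece_weight (fib (label L c) k) (nbrs A L c k)].
Proof.
have [s hyp] := hyperfinite C_gt0 H_sparse D q; exists s => m.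
set K0 := #|piece_code s C.+1|.
(* [E1 * #|A| + E0] will bound [q] times the degree sum of the low vertices in discarded
   clusters. *)
pose E1 := q * D * s * (C + K0 * 2 ^ C * m).
pose E0 := q * D * s * (K0 * m).
(* Degrees above [D'] make [#|A| * (2 * E1 + q * C)] at most [#|G|], and [2 * E0 <= #|G|] takes care
   of the constant term. *)
exists (D + C * (2 * E1 + q * C)), (2 * E0); set D' := D + _ => G HG bigG mid.
pose A := [set x : G | D' < degree x]; pose L := [set x : G | degree x <= D].
pose M := [set x : G | D < degree x <= D'].
have degL : {in L, forall x, degree x <= D} by move=> x; rewrite inE.
have [c [cC cs cr]] := hyp G L HG degL.
have dAL : [disjoint A & L].
  rewrite disjoints_subset; apply/subsetP => x; rewrite !inE -ltnNge => h.
  by apply: leq_ltn_trans h; apply: leq_addr.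
have [B [r [Bcard r_sparse rcl]]] := clique_nbrs H_sparse HG dAL cC.
set fb := fib (label L c); set nb := nbrs A L c.
have nbA k : nb k \subset A by apply/subsetP => x; rewrite inE => /andP[].
pose key k := (encode s C.+1 k (fb k) (nb k), nb k).
pose live := [set k | (k \notin B) && (fb k != set0)].
pose grp k := [set k' in live | key k' == key k].
pose U := [set k in live | m <= #|grp k|].
pose small := [set k in live | #|grp k| < m].
(* A key is a code together with a clique inside [A]; [card_cliques] bounds the number of keys, and
   each rare key has fewer than [m] clusters. *)
have small_card : #|small| <= K0 * (1 + 2 ^ C * #|A|) * m.
  have -> : small = \bigcup_(e in key @: small) [set k in small | key k == e].
    apply/setP => k; apply/idP/bigcupP => [ks|[e _]]; last by rewrite inE => /andP[].
    by exists (key k); [apply: imset_f | rewrite inE ks eqxx].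
  apply: leq_trans (card_bigcup_le (m := m) _) _.
    move=> _ /imsetP[k ks ->]; apply: (@leq_trans #|grp k|); last first.
      by move: ks; rewrite inE => /andP[_ /ltnW].
    apply: subset_leq_card; apply/subsetP => k'; rewrite !inE => /andP[/andP[-> _]].
    by [].
  rewrite leq_mul2r; apply/orP; right.
  apply: leq_trans (leq_mul (leqnn K0) (card_cliques r_sparse A)).
  rewrite /K0 -cardsT -cardsX; apply: subset_leq_card.
  apply/subsetP => _ /imsetP[k + ->]; rewrite !inE => /andP[/andP[kB _] _].
  by rewrite nbA rcl.
pose Vb := [set x in L | c x \notin U].
have Vb_card : #|Vb| <= (C * #|A| + K0 * (1 + 2 ^ C * #|A|) * m) * s.
  apply: (@leq_trans (#|B :|: small| * s)); last first.
    rewrite leq_mul2r; apply/orP; right; rewrite cardsU.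
    by apply: leq_trans (leq_subr _ _) _; apply: leq_add.
  apply: leq_trans (card_bigcup_le (F := fb) (m := s) _); last by move=> k _; apply: cs.
  apply: subset_leq_card; apply/subsetP => x; rewrite inE => /andP[xL xU].
  apply/bigcupP; exists (c x); last by rewrite label_fib xL eqxx.
  have fx : fb (c x) != set0 by apply/set0Pn; exists x; rewrite label_fib xL eqxx.
  by move: xU; rewrite !inE fx; case: (c x \in B) => //=; rewrite -ltnNge.
have A_card : #|A| * (C * (2 * E1 + q * C)) <= C * #|G|.
  apply: leq_trans (H_sparse HG); rewrite -sum_nat_const.
  apply: (@leq_trans (\sum_(x in A) degree x)).
    by apply: leq_sum => x; rewrite inE => /ltnW; apply: leq_trans; apply: leq_addl.
  by rewrite big_mkcond; apply: leq_sum => x _; case: ifP.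
have {}A_card : #|A| * (2 * E1 + q * C) <= #|G|.
  by move: A_card; rewrite mulnCA leq_mul2l eqn0Ngt C_gt0.
have Vb_deg : q * \sum_(x in Vb) degree x <= #|G|.
  apply: (@leq_trans (E1 * #|A| + E0)); last by move: A_card bigG; nia.
  apply: (@leq_trans (q * (#|Vb| * D))).
    rewrite leq_mul2l -sum_nat_const; apply/orP; right; apply: leq_sum => x.
    by rewrite inE => /andP[/degL].
  apply: (@leq_trans (q * (((C * #|A| + K0 * (1 + 2 ^ C * #|A|) * m) * s) * D))).
    by rewrite leq_mul2l leq_mul2r Vb_card !orbT.
  by rewrite /E1 /E0 eq_leq //; ring.
have AA : \sum_(x in A) \sum_(y in A) (adj x y : nat) <= C * #|A|.
  rewrite -arcs_induced -[#|A|]card_induced; apply: H_sparse.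
  by move/(minor_subgraph (induced_subgraph A)).
have live_U k : k \in U -> k \in live by rewrite inE => /andP[].
exists A, L, c, U; split=> //.
  move=> k kU; have := live_U _ kU; rewrite inE => /andP[kB k0]; split=> //.
    by apply: (card_clique r_sparse); apply: rcl.
  move: kU; rewrite inE => /andP[_]; move/leq_trans; apply.
  apply: subset_leq_card; apply/subsetP => k'; rewrite !inE /key xpair_eqE.
  by case/andP=> _ /andP[-> ->].
pose W := [set x in L | c x \in U].
have part (f : G -> nat) : \sum_(x in W) f x = \sum_(k in U) \sum_(x in fb k) f x.
  rewrite (partition_big c (mem U)) => [|x]; last by rewrite inE => /andP[].
  apply: eq_bigr => k kU; apply: eq_bigl => x; rewrite label_fib inE -andbA.
  have {}kU : k \in U := kU.
  by congr (_ && _); case: eqP => [->|]; rewrite ?kU ?andbF.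
have nbsum x : x \in L -> \sum_(a in nb (c x)) (adj x a : nat) = \sum_(a in A) (adj x a : nat).
  move=> xL; rewrite big_mkcond [RHS]big_mkcond; apply: eq_bigr => a _.
  rewrite [in LHS]inE; case: (boolP (a \in A)) => //= aA.
  case xa: (adj x a); last by rewrite if_same.
  case: ifP => // /existsP[]; exists x; by rewrite label_fib xL eqxx xa.
have -> : \sum_(k in U) piece_weight (fb k) (nb k) =
    \sum_(x in W) \sum_(y in W) ((c x == c y) * adj x y) +
    2 * \sum_(x in W) \sum_(a in A) (adj x a : nat).
  rewrite /piece_weight big_split /= -big_distrr /= !part; congr (_ + 2 * _).
    apply: eq_bigr => k kU; apply: eq_bigr => x; rewrite label_fib => /andP[xL /eqP xk].
    rewrite big_mkcond [RHS]big_mkcond; apply: eq_bigr => y _.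
    rewrite label_fib [y \in W]inE xk [k == c y]eq_sym; case: (y \in L) => //=.
    by case: (eqVneq (c y) k) => [->|_]; rewrite ?mul0n ?if_same // kU mul1n.
  apply: eq_bigr => k kU; apply: eq_bigr => x; rewrite label_fib => /andP[xL /eqP <-].
  exact: nbsum.
(* An arc has an end of medium degree, or an end in a discarded cluster, or both ends in [A], or it
   crosses between clusters, or it is counted by a piece. Once multiplied by [q], the first four
   kinds cost at most 2, 2, 1 and 1 times [#|G|], which gives the 6. *)
have main : arcs G <= 2 * \sum_(x in M) degree x + 2 * \sum_(x in Vb) degree x +
   C * #|A| + cross L c + (\sum_(x in W) \sum_(y in W) ((c x == c y) * adj x y) +
    2 * \sum_(x in W) \sum_(a in A) (adj x a : nat)).
  have dd (S : {set G}) : 2 * \sum_(x in S) degree x =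
     \sum_x \sum_y ((x \in S) * adj x y + (y \in S) * adj x y).
    rewrite mul2n -addnn; under [RHS]eq_bigr do rewrite big_split /=.
    rewrite big_split /=; congr (_ + _); last rewrite [RHS]exchange_big /=.
      rewrite big_mkcond; apply: eq_bigr => x _; rewrite -big_distrr /=.
      by case: (x \in S); rewrite ?mul1n ?mul0n.
    rewrite big_mkcond; apply: eq_bigr => x _; rewrite -big_distrr /=.
    rewrite (eq_bigr (fun y => nat_of_bool (adj x y))) => [|y _]; last by rewrite adj_sym.
    by case: (x \in S); rewrite ?mul1n ?mul0n.
  have ss (S S' : {set G}) (f : G -> G -> nat) : \sum_(x in S) \sum_(y in S') f x y =
     \sum_x \sum_y ((x \in S) && (y \in S')) * f x y.
    rewrite big_mkcond; apply: eq_bigr => x _; rewrite big_mkcond.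
    case: (x \in S) => /=; last by rewrite big1.
    by apply: eq_bigr => y _; case: (y \in S'); rewrite ?mul1n ?mul0n.
  have s2 : 2 * \sum_(x in W) \sum_(a in A) (adj x a : nat) =
     \sum_x \sum_y (((x \in W) && (y \in A)) * adj x y + ((x \in A) && (y \in W)) * adj x y).
    rewrite mul2n -addnn; under [RHS]eq_bigr do rewrite big_split /=.
    rewrite big_split /=; congr (_ + _); rewrite ss // exchange_big.
    by apply: eq_bigr => x _; apply: eq_bigr => y _; rewrite adj_sym andbC.
  apply: (@leq_trans (2 * \sum_(x in M) degree x + 2 * \sum_(x in Vb) degree x +
   \sum_(x in A) \sum_(y in A) (adj x y : nat) + cross L c +
   (\sum_(x in W) \sum_(y in W) ((c x == c y) * adj x y) +
    2 * \sum_(x in W) \sum_(a in A) (adj x a : nat)))); last by move: AA; lia.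
  rewrite !dd s2 /cross !ss -!big_split /=; apply: leq_sum => x _.
  rewrite -!big_split /=; apply: leq_sum => y _.
  case: (adj x y); rewrite ?muln0 // !muln1.
  have dc z : [|| z \in M, z \in Vb, z \in A | (z \in W) && (z \in L)].
    rewrite [z \in M]inE [z \in Vb]inE [z \in A]inE [z \in W]inE.
    have zL : (z \in L) = (degree z <= D) by rewrite inE.
    case: (boolP (z \in L)) => zL'; first by case: (c z \in U); rewrite ?orbT.
    have -> : D < degree z by rewrite ltnNge -zL.
    by case: (leqP (degree z) D'); rewrite ?orbT.
  move: (dc x) (dc y).
  move: (x \in M) (y \in M) (x \in Vb) (y \in Vb) (x \in A) (y \in A)
    (x \in W) (y \in W) (x \in L) (y \in L) (c x == c y).
  by case=> // [] [] // [] // [] // [] // [] // [] [] [] [] [].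
rewrite (leq_trans (leq_mul (leqnn q) main)) //.
have mid' : q * \sum_(x in M) degree x <= #|G|.
  apply: leq_trans mid; rewrite leq_mul2l; apply/orP; right.
  by rewrite eq_leq //; apply: eq_bigl => x; rewrite inE.
have Lle : #|L| <= #|G| by apply: max_card.
have cr' := leq_trans cr Lle.
have : q * (C * #|A|) <= #|G| by move: A_card; nia.
have arith a b d e Z n : q * a <= n -> q * b <= n -> q * d <= n -> q * e <= n ->
    q * (2 * a + 2 * b + d + e + Z) <= 6 * n + q * Z.
  by lia.
by move=> CA; apply: arith.
Qed.

End Pieces.

End Fans.

(** * Recovering fans from the codes of clusters *)

Section Decoding.
Import mathcomp.boot.fintype mathcomp.boot.finset.
Local Open Scope set_scope.
Local Open Scope nat_scope.

Section Decode.
Variables (s t : nat) (x : piece_code s t).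

(** An arbitrary code need not hold a symmetric irreflexive matrix, so both properties are imposed;
    for codes of actual clusters this changes nothing. *)
Definition piece_adj : rel 'I_(x.1.1.1) := fun i j =>
  [&& i != j, x.1.2 (inord i, inord j) & x.1.2 (inord j, inord i)].

Lemma piece_sym : symmetric piece_adj.
Proof. by move=> i j; rewrite /piece_adj eq_sym [X in _ && X]andbC. Qed.

Lemma piece_irr : irreflexive piece_adj.
Proof. by move=> i; rewrite /piece_adj eqxx. Qed.

Definition piece : sgraph := SGraph piece_sym piece_irr.

Definition piece_roots (i : piece) (a : 'I_(x.1.1.2)) : bool :=
  x.2 (inord (i : 'I_(x.1.1.1)), inord a).

End Decode.

(** The isomorphism lists the cluster in the order of [enum K]. The default [y0] is free because
    root indices are in range, so copies encoded with different defaults can share one list of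
    roots. *)
Lemma encode_piece (G : sgraph) s t (x0 : G) (K N : {set G}) (x : piece_code s t) :
  #|K| <= s -> #|N| <= t -> encode s t x0 K N = x ->
  exists f : piece x -> G,
    [/\ injective f, f @: [set: piece x] = K,
        forall i j, adj i j = adj (f i) (f j),
        (x.1.1.2 : nat) = #|N| &
        forall y0 i a, piece_roots i a = adj (f i) (nth y0 (enum N) a)].
Proof.
move=> Ks Nt ex.
have pE : (x.1.1.1 : nat) = #|K| by rewrite -ex /= inordK.
have rE : (x.1.1.2 : nat) = #|N| by rewrite -ex /= inordK.
have ltK (i : piece x) : (i : 'I_(x.1.1.1)) < #|K| by rewrite -pE.
have inK (i : piece x) : (inord (i : 'I_(x.1.1.1)) : 'I_s.+1) = (i : 'I_(x.1.1.1)) :> nat.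
  by rewrite inordK // ltnS ltnW // (leq_trans (ltK i)).
have finj : injective (fun i : piece x => nth x0 (enum K) (i : 'I_(x.1.1.1))).
  move=> i j /eqP; rewrite nth_uniq ?enum_uniq -?cardE ?ltK // => /eqP ij.
  exact: val_inj.
exists (fun i => nth x0 (enum K) (i : 'I_(x.1.1.1))); split=> //.
- apply/setP => y; apply/imsetP/idP => [[i _ ->]|yK].
    by rewrite -mem_enum mem_nth // -cardE ltK.
  have yi : index y (enum K) < x.1.1.1 by rewrite pE cardE index_mem mem_enum.
  by exists (Ordinal yi) => //=; rewrite nth_index // mem_enum.
- move=> i j; rewrite -[LHS]/(piece_adj i j) /piece_adj.
  have E i' j' : x.1.2 (inord (i' : 'I_(x.1.1.1)), inord (j' : 'I_(x.1.1.1))) =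
      adj (nth x0 (enum K) (i' : 'I_(x.1.1.1))) (nth x0 (enum K) (j' : 'I_(x.1.1.1))).
    by rewrite -{1}ex ffunE /= (inK i') (inK j').
  rewrite !E [in X in _ && (_ && X)]adj_sym andbb; case: (eqVneq i j) => //= ->.
  by rewrite adj_irr.
- move=> y0 i a; have aN : a < #|N| by rewrite -rE.
  rewrite /piece_roots -{1}ex ffunE /= (inK i) inordK; last by rewrite ltnS ltnW // (leq_trans aN).
  by congr adj; apply: set_nth_default; rewrite -cardE.
Qed.

Section DecodedFan.
Variables (G : sgraph) (A L : {set G}) (c : G -> G) (s t : nat).
Hypothesis dAL : [disjoint A & L].
Hypothesis sizeK : forall k, #|fib (label L c) k| <= s.

Let K k := fib (label L c) k.
Let N k := nbrs A L c k.

Lemma decoded_weight (k : G) (x : piece_code s t) :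
  #|N k| <= t -> encode s t k (K k) (N k) = x ->
  #|piece x| = #|K k| /\ fan_weight (@piece_roots s t x) = piece_weight (K k) (N k).
Proof.
move=> Nt ex; have [f [finj fK fadj rE fF]] := encode_piece (sizeK k) Nt ex.
split; first by rewrite /K -fK card_imset // cardsT.
have sumK (h : G -> nat) : \sum_(y in K k) h y = \sum_i h (f i).
  rewrite /K -fK big_imset => [|i j _ _ /finj//].
  by apply: eq_bigl => i; rewrite inE.
rewrite /fan_weight /piece_weight /arcs !sumK; congr (_ + 2 * _).
  by apply: eq_bigr => i _; rewrite sumK; apply: eq_bigr => j _; rewrite fadj.
apply: eq_bigr => i _; rewrite -[in RHS]big_enum /= (big_nth k) -cardE big_mkord.
rewrite -rE; by apply: eq_bigr => a _; rewrite (fF k).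
Qed.

Lemma decoded_connected (k : G) (x : piece_code s t) :
  #|N k| <= t -> encode s t k (K k) (N k) = x -> conn (K k) ->
  forall p p' : piece x, connect (@adj (piece x)) p p'.
Proof.
move=> Nt ex Kc p p'; have [f [finj fK fadj _ _]] := encode_piece (sizeK k) Nt ex.
have fin i : f i \in K k by rewrite /K -fK imset_f.
pose g y := odflt p [pick i | f i == y].
have gK i : g (f i) = i.
  by rewrite /g; case: pickP => [j /eqP/finj//|/(_ i)]; rewrite eqxx.
rewrite -(gK p) -(gK p'); have := Kc _ _ (fin p) (fin p').
apply: connect_homo => y z /and3P[yz]; rewrite -/(K k) /K -fK.
move=> /imsetP[i _ yE] /imsetP[j _ zE]; rewrite yE zE !gK; apply: connect1.
by rewrite fadj -yE -zE.
Qed.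

Lemma decoded_rooted (k : G) (x : piece_code s t) :
  #|N k| <= t -> encode s t k (K k) (N k) = x ->
  forall a, exists p : piece x, piece_roots p a.
Proof.
move=> Nt ex a; have [f [_ fK _ rE fF]] := encode_piece (sizeK k) Nt ex.
have aN : nth k (enum (N k)) a \in N k.
  by rewrite -mem_enum mem_nth // -cardE -rE.
move: (aN); rewrite inE => /andP[_ /existsP[y /andP[]]].
rewrite -/(K k) /K -fK => /imsetP[i _ ->] ia.
by exists i; rewrite (fF k).
Qed.

(** Copies with equal neighbourhoods attach to the same roots in the same order; clusters with
    distinct names are disjoint, and [A] is disjoint from all of them. *)
Lemma decoded_fan (k : G) (x : piece_code s t) m :
  #|N k| <= t -> encode s t k (K k) (N k) = x ->
  m <= #|[set k' | (N k' == N k) &&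
           (encode s t k' (K k') (N k') == encode s t k (K k) (N k))]| ->
  subgraph (fan (@piece_roots s t x) 'I_m) G.
Proof.
move=> Nt ex /card_geqP[ks [ks_uniq ks_size ks_sub]].
have grp (i : 'I_m) : N (nth k ks i) = N k /\ encode s t (nth k ks i) (K (nth k ks i)) (N k) = x.
  have := ks_sub (nth k ks i); rewrite mem_nth ?ks_size // inE => /(_ isT).
  by move=> /andP[/eqP -> /eqP ->].
have /choice[f fP] (i : 'I_m) : exists f : piece x -> G,
    [/\ injective f, f @: [set: piece x] = K (nth k ks i),
        forall p q, adj p q = adj (f p) (f q) &
        forall p a, piece_roots p a = adj (f p) (nth k (enum (N k)) a)].
  have [Ni ei] := grp i.
  have [f [? ? ? _ fF]] := encode_piece (sizeK (nth k ks i)) Nt ei.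
  by exists f; split.
have rE : (x.1.1.2 : nat) = #|N k|.
  by have [f' [_ _ _ rE _]] := encode_piece (sizeK k) Nt ex.
have fL i p : f i p \in K (nth k ks i) by have [_ <- _ _] := fP i; rewrite imset_f.
have aA (a : 'I_(x.1.1.2)) : nth k (enum (N k)) a \in A.
  have : nth k (enum (N k)) a \in N k by rewrite -mem_enum mem_nth // -cardE -rE.
  by rewrite inE => /andP[].
have AfL a i p : nth k (enum (N k)) (a : 'I_(x.1.1.2)) <> f i p.
  move=> E; have := aA a; rewrite E => fA.
  by have := fL i p; rewrite label_fib => /andP[fLi _]; rewrite (disjointFr dAL fA) in fLi.
pose e (v : fan (@piece_roots s t x) 'I_m) : G :=
  match v with inl a => nth k (enum (N k)) a | inr (p, i) => f i p end.
exists e.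
  move=> [a|[p i]] [b|[q j]] /=.
  - move=> /eqP; rewrite nth_uniq ?enum_uniq -?cardE -?rE // => /eqP ab.
    by congr inl; apply: val_inj.
  - by move=> /AfL.
  - by move=> /esym/AfL.
  move=> E; have ij : i = j.
    have := fL i p; have := fL j q; rewrite E !label_fib => /andP[_ /eqP->] /andP[_].
    by rewrite nth_uniq ?ks_size // eq_sym => /eqP/val_inj.
  by subst j; have [finj _ _ _] := fP i; rewrite (finj _ _ E).
move=> [a|[p i]] [b|[q j]] //=.
- by have [_ _ _ ->] := fP j; rewrite adj_sym.
- by have [_ _ _ ->] := fP i.
have [_ _ adjE _] := fP i; case/andP=> /eqP <-.
by rewrite -adjE.
Qed.

End DecodedFan.

Lemma sum_card_fib (G : sgraph) (L : {set G}) (c : G -> G) (U : {set G}) :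
  \sum_(k in U) #|fib (label L c) k| <= #|G|.
Proof.
apply: (@leq_trans (\sum_k #|fib (label L c) k|)).
  by rewrite [leqLHS]big_mkcond; apply: leq_sum => k _; case: ifP.
apply: (@leq_trans #|L|); last exact: max_card.
rewrite -[#|L|]sum1_card [leqRHS](partition_big c predT) //= eq_leq //.
apply: eq_bigr => k _; rewrite -sum1_card; apply: eq_bigl => x.
by rewrite label_fib.
Qed.

End Decoding.

(** * Existence of dense fans *)

Section FanExists.
Local Open Scope ring_scope.

(** The pieces of [many_pieces] carry almost all arcs of [G] on at most [#|G|] vertices, so by
    averaging one of them has the required weight per vertex; it comes with [m] copies, and
    finiteness of the codes removes the dependence on [m]. *)
Lemma fan_exists (R : realType) (H : sgraph) (d d' : R) :
  0 <= d' -> d' < d ->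
  (forall n, exists G : sgraph, [/\ (n <= #|G|)%N, ~ minor H G &
     d * 2 * #|G|%:R <= (arcs G)%:R]) ->
  exists (P : sgraph) (T : finType) (F : P -> T -> bool),
    [/\ (0 < #|P|)%N, forall p p' : P, connect (@adj P) p p',
        forall t, exists p, F p t,
        forall I : finType, ~ minor H (fan F I) &
        d' * 2 * #|P|%:R <= (fan_weight F)%:R].
Proof.
move=> d'0 d'd dense; have [C C0 HC] := mader H.
have dd : 0 < d - d' by rewrite subr_gt0.
(* With this [q] the lost arcs, at most [6 * #|G| / q], are fewer than the slack
   [2 * (d - d') * #|G|]. *)
pose q := Num.bound (3 / (d - d')).
have qP : 3 < q%:R * (d - d').
  rewrite -ltr_pdivrMr //; apply: archi_boundP.
  by rewrite divr_ge0 // ltW.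
pose Cl (G : sgraph) := ~ minor H G /\ d * 2 * #|G|%:R <= (arcs G)%:R.
have [D DP] : exists D, forall D' N, exists G, [/\ Cl G, (N <= #|G|)%N &
    (q * \sum_(x : G | (D < degree x <= D')%N) degree x <= #|G|)%N].
  apply: (degree_gap (C := C)) => [G []|N]; first by move=> /HC.
  by have [G [GN GH Gd]] := dense N; exists G.
have [s sP] := many_pieces C0 HC D q.
pose Q (x : piece_code s C.+1) m :=
  [/\ (0 < #|piece x|)%N, forall p p' : piece x, connect (@adj (piece x)) p p',
      forall a, exists p : piece x, piece_roots p a,
      ~ minor H (fan (@piece_roots _ _ x) 'I_m) &
      d' * 2 * #|piece x|%:R <= (fan_weight (@piece_roots _ _ x))%:R].
suff [x Qx] : exists x, forall m, Q x m.
  exists (piece x), _, (@piece_roots _ _ x); have [? ? ? _ ?] := Qx 0%N; split=> //.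
  move=> I; have [_ _ _ nm _] := Qx #|I|; apply: contra_not nm.
  by apply: minor_subgraph; apply: fan_subgraph; rewrite card_ord.
apply: pigeonhole_all => [x m m' mm' [? ? ? nm ?]|m].
  split=> //; apply: contra_not nm; apply: minor_subgraph.
  by apply: fan_subgraph; rewrite !card_ord.
have [D' [N sP']] := sP m.
have [G [[GH Gd] Gbig mid]] := DP D' (maxn N 1).
move: Gbig; rewrite geq_max => /andP[GN G1].
have [A [L [c [U [dAL cC cs UP main]]]]] := sP' G GH GN mid.
have [k kU wk] : exists2 k, k \in U & d' * 2 * #|fib (label L c) k|%:R <=
    (piece_weight (fib (label L c) k) (nbrs A L c k))%:R.
  apply: contrapT => no.
  have lt : (\sum_(k in U) piece_weight (fib (label L c) k) (nbrs A L c k))%:R <=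
      d' * 2 * (\sum_(k in U) #|fib (label L c) k|)%:R.
    rewrite !natr_sum mulr_sumr; apply: ler_sum => k kU.
    by rewrite leNgt; apply/negP => /ltW h; apply: no; exists k.
  have lt2 : d' * 2 * (\sum_(k in U) #|fib (label L c) k|)%:R <= d' * 2 * #|G|%:R.
    by rewrite ler_wpM2l ?mulr_ge0 // ler_nat sum_card_fib.
  have {}lt := le_trans lt lt2.
  move: main; rewrite -(ler_nat R) natrD !natrM => main.
  have G1' : 0 < #|G|%:R :> R by rewrite ltr0n.
  have q0 : 0 <= q%:R :> R by [].
  move: main lt Gd; move: (\sum_(k in U) _)%:R (arcs G)%:R #|G|%:R q%:R G1' q0 qP.
  move=> w a g q' g0 q0 qP' main lt Gd.
  have h1 := ler_wpM2l q0 lt; have h2 := ler_wpM2l q0 Gd.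
  have h3 : 6 * g < q' * (d - d') * 2 * g by rewrite ltr_pM2r //; lra.
  by lra.
have [k0 Nk mk] := UP _ kU.
pose x := encode s C.+1 k (fib (label L c) k) (nbrs A L c k).
have [Px wx] := decoded_weight cs Nk (erefl x).
exists x; split.
- by rewrite Px card_gt0.
- move=> p p'; exact: (decoded_connected cs Nk (erefl x) (cC k) p p').
- move=> a; exact: (decoded_rooted cs Nk (erefl x) a).
- apply: contra_not GH; apply: minor_subgraph.
  exact: (decoded_fan dAL cs Nk (erefl x) mk).
- by rewrite Px wx.
Qed.

End FanExists.

(** * The limit density *)

Section Limits.
Import mathcomp.boot.fintype mathcomp.boot.finset.
Local Open Scope set_scope.
Local Open Scope ring_scope.

Lemma superset_of_card (T : finType) (Y : {set T}) n :
  (#|Y| <= n <= #|T|)%N -> exists2 X : {set T}, Y \subset X & #|X| = n.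
Proof.
move=> /andP[Yn nT].
have : (n - #|Y| <= #|~: Y|)%N by rewrite [#|~: Y|]cardsCs setCK leq_sub2r.
case/card_geqP => s [s_uniq s_size s_sub].
exists (Y :|: [set x in s]); first exact: subsetUl.
rewrite cardsU; have -> : Y :&: [set x in s] = set0.
  apply/setP => x; rewrite !inE; apply/negP => /andP[xY /s_sub].
  by rewrite inE xY.
by rewrite cards0 subn0 cardsE (card_uniqP s_uniq) s_size subnKC.
Qed.

(** As [max_density] asks for exactly [n] vertices, a fan with as many full copies as fit is padded
    with vertices of one further copy. *)
Lemma fan_restriction (P : sgraph) (T : finType) (F : P -> T -> bool) n :
  (0 < #|P|)%N -> (#|T| <= n)%N ->
  exists G : sgraph, [/\ #|G| = n, exists I : finType, subgraph G (fan F I) &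
    ((n - #|T|) %/ #|P| * fan_weight F <= arcs G)%N].
Proof.
move=> P0 Tn; set m := ((n - #|T|) %/ #|P|)%N.
have mP : (m * #|P| <= n - #|T|)%N by apply: leq_trunc_div.
have mP' : (n - #|T| < m.+1 * #|P|)%N by apply: ltn_ceil.
have [f finj fadj] : subgraph (fan F 'I_m) (fan F 'I_m.+1).
  by apply: fan_subgraph; rewrite !card_ord.
have [X YX Xn] : exists2 X : {set fan F 'I_m.+1},
    [set f x | x in [set: fan F 'I_m]] \subset X & #|X| = n.
  apply: superset_of_card; rewrite card_imset // cardsT !card_fan !card_ord.
  by move: mP mP'; lia.
exists (induced_graph X); split; first by rewrite card_induced.
  by exists 'I_m.+1; apply: induced_subgraph.
have -> : (m * fan_weight F)%N = arcs (fan F 'I_m) by rewrite arcs_fan card_ord.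
have fX x : f x \in X by apply: (subsetP YX); rewrite imset_f.
apply: arcs_subgraph; exists (fun x => exist (fun y => y \in X) (f x) (fX x)).
  by move=> x y [] /finj.
by move=> x y /fadj.
Qed.

Section MaxDensity.
Variables (R : realType) (H : sgraph).

Let u : nat -> R := max_density R H.

Lemma density_arcs (G : sgraph) : density R G = (arcs G)%:R / (2 * #|G|%:R).
Proof.
rewrite /density arcs_nedges -mul2n natrM invfM mulrA; congr (_ / _).
by rewrite mulrC mulKf // pnatr_eq0.
Qed.

Lemma max_density_ge0 n : 0 <= u n.
Proof.
have [/max_densityP[[G [_ _ dG]] _]|/set0P/negP/negPn/eqP E] :=
  pselect (@minor_free_densities R H n !=set0)%classic.
  by rewrite /u -dG /density divr_ge0.
by rewrite /u /max_density E sup0.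
Qed.

Lemma max_density_le C : (forall G : sgraph, ~ minor H G -> (arcs G <= C * #|G|)%N) ->
  forall n, u n <= C%:R.
Proof.
move=> HC n.
have [/max_densityP[[G [_ HG dG]] _]|/set0P/negP/negPn/eqP E] :=
  pselect (@minor_free_densities R H n !=set0)%classic; last first.
  by rewrite /u /max_density E sup0.
rewrite /u -dG density_arcs.
have [->|G0] := posnP #|G|; first by rewrite mulr0 invr0 mulr0.
rewrite ler_pdivrMr; last by rewrite mulr_gt0 // ltr0n.
have := HC _ HG; rewrite -(ler_nat R) natrM => /le_trans; apply.
rewrite ler_wpM2l // ler_peMl // ler1n //.
Qed.

Lemma density_le_max (G : sgraph) : ~ minor H G -> density R G <= u #|G|.
Proof.
move=> HG; have inG : @minor_free_densities R H #|G| (density R G) by exists G.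
by have [_] := max_densityP (ex_intro _ _ inG); apply.
Qed.

(** Positivity of [d] excludes those [n] where no graph avoids [H] and the maximum defaults to 0. *)
Lemma dense_graphs (d : R) : 0 < d -> (forall N, exists2 n, (N <= n)%N & d <= u n) ->
  forall n, exists G : sgraph, [/\ (n <= #|G|)%N, ~ minor H G &
     d * 2 * #|G|%:R <= (arcs G)%:R].
Proof.
move=> d0 du N; have [n] := du (maxn N 1); rewrite geq_max => /andP[Nn n0] dn.
have [/max_densityP[[G [Gn HG dG]] _]|/set0P/negP/negPn/eqP E] :=
  pselect (@minor_free_densities R H n !=set0)%classic; last first.
  by move: dn; rewrite /u /max_density E sup0 leNgt d0.
exists G; rewrite Gn; split=> //.
move: dn; rewrite /u -dG density_arcs Gn ler_pdivlMr; first by rewrite mulrA.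
by rewrite mulr_gt0 // ltr0n.
Qed.

(** The roots and the incomplete copy cost a bounded number of arcs, which the strict inequality
    absorbs for large [n]. *)
Lemma fan_max_density (P : sgraph) (T : finType) (F : P -> T -> bool) (x : R) :
  (0 < #|P|)%N -> (forall I : finType, ~ minor H (fan F I)) ->
  x * 2 * #|P|%:R < (fan_weight F)%:R -> exists N, forall n, (N <= n)%N -> x <= u n.
Proof.
move=> P0 HF xw.
have [x0|x0] := leP x 0; first by exists 0%N => n _; apply: le_trans (max_density_ge0 n).
set w : R := (fan_weight F)%:R; set p : R := #|P|%:R; set t : R := #|T|%:R.
have e0 : 0 < w - x * 2 * p by rewrite subr_gt0.
(* Solves [(n - t - p) * w >= 2 * x * n * p] for [n]. *)
pose N := Num.bound ((w * (t + p)) / (w - x * 2 * p)).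
exists (maxn N #|T|).+1 => n; rewrite gtn_max => /andP[Nn Tn].
have [G [Gn [I GI] wG]] := fan_restriction F P0 (ltnW Tn).
have HG : ~ minor H G by apply: contra_not (HF I); apply: minor_subgraph.
have := density_le_max HG; rewrite Gn; apply: le_trans.
have n0 : 0 < n%:R :> R by rewrite ltr0n (leq_ltn_trans (leq0n _) Tn).
rewrite density_arcs Gn ler_pdivlMr; last by rewrite mulr_gt0.
have p0 : 0 < p by rewrite ltr0n.
rewrite -(ler_pM2r p0).
have w0 : 0 <= w by [].
have t0 : 0 <= t by [].
have big : w * (t + p) < n%:R * (w - x * 2 * p).
  rewrite -ltr_pdivrMr //; apply: (@lt_le_trans _ _ N%:R).
    by apply: archi_boundP; rewrite divr_ge0 ?(ltW e0) // mulr_ge0 // addr_ge0.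
  by rewrite ler_nat ltnW.
have low : (n%:R - t - p) * w <= (arcs G)%:R * p.
  have : (((n - #|T|) %/ #|P|).+1 * #|P|)%:R >= (n - #|T|)%:R :> R.
    by rewrite ler_nat ltnW // ltn_ceil.
  rewrite natrM natrB ?(ltnW Tn) // -natr1 mulrDl mul1r -/t -/p => mP.
  move: wG; rewrite -(ler_nat R) natrM -/w => wG.
  move: mP wG; move: ((_ %/ _)%:R) => m mP wG.
  have := ler_wpM2r (ltW p0) wG.
  have : (n%:R - t - p) * w <= m * p * w by rewrite ler_wpM2r //; lra.
  lra.
apply: le_trans low.
lra.
Qed.

(** The limit is the limsup: a density reached infinitely often is, up to any error, that of fans,
    and fans supply graphs on every large number of vertices. *)
Lemma max_density_cvg : cvgn u.
Proof.
have [C _ HC] := mader H.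
have uC := max_density_le HC.
pose E : set R := [set d | forall N, exists2 n, (N <= n)%N & d <= u n]%classic.
have E0 : E 0 by move=> N; exists N => //; apply: max_density_ge0.
have Eub : has_sup E.
  split; first by exists 0.
  by exists C%:R => d /(_ 0%N)[n _] /le_trans; apply; apply: uC.
apply/cvg_ex; exists (sup E); apply/cvgrPdist_le => e e0.
have up : exists N, forall n, (N <= n)%N -> u n < sup E + e.
  apply: contrapT => no.
  have : E (sup E + e).
    move=> N; apply: contrapT => h; apply: no; exists N => n Nn.
    by rewrite ltNge; apply/negP => le; apply: h; exists n.
  move/(ub_le_sup Eub.2); lra.
have lo : exists N, forall n, (N <= n)%N -> sup E - e <= u n.
  have [s0|s0] := leP (sup E - e) 0.
    by exists 0%N => n _; apply: le_trans s0 (max_density_ge0 n).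
  (* One third of [e] is lost in approaching the supremum and one third in passing to a fan, which
     leaves strict room. *)
  have [d Ed] := sup_adherent (divr_gt0 e0 (ltr0n R 3)) Eub => dlt.
  have d0 : 0 < d by move: dlt; lra.
  have d'0 : 0 <= d - e / 3 by move: dlt; lra.
  have d'd : d - e / 3 < d by lra.
  have [P [T [F [P0 _ _ HF w]]]] := fan_exists d'0 d'd (dense_graphs d0 Ed).
  have [|N uN] := @fan_max_density P T F (sup E - e) P0 HF.
    apply: lt_le_trans w; rewrite ltr_pM2r ?ltr0n // ltr_pM2r ?ltr0n //.
    by move: dlt; lra.
  by exists N.
have [N1 h1] := up; have [N2 h2] := lo.
near=> n; rewrite ler_distlC; apply/andP; split.
  by apply: h2; near: n; exists N2.
by apply/ltW/h1; near: n; exists N1.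
Unshelve. all: by end_near. Qed.

Lemma c_infty_cvg : (u @ \oo --> c_infty R H)%classic.
Proof. exact: max_density_cvg. Qed.

Lemma le_c_infty (x : R) :
  (exists N, forall n, (N <= n)%N -> x <= u n) -> x <= c_infty R H.
Proof.
move=> [N xu]; apply: limr_ge; first exact: max_density_cvg.
by exists N.
Qed.

Lemma lt_c_infty (x : R) : x < c_infty R H ->
  exists N, forall n, (N <= n)%N -> x <= u n.
Proof.
move=> xc; have /cvgrPdist_lt := c_infty_cvg.
move=> /(_ (c_infty R H - x)); rewrite subr_gt0 => /(_ xc) [N _ h].
exists N => n Nn; have := h n Nn; rewrite /= ltr_distlC => /andP[+ _].
by lra.
Qed.

Lemma c_infty_ge0 : 0 <= c_infty R H.
Proof. by apply: le_c_infty; exists 0%N => n _; apply: max_density_ge0. Qed.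

Lemma dense_fan_minor (P : sgraph) (T : finType) (F : P -> T -> bool) (x : R) :
  (0 < #|P|)%N -> c_infty R H < x -> x * 2 * #|P|%:R <= (fan_weight F)%:R ->
  exists I : finType, minor H (fan F I).
Proof.
move=> P0 cx w; apply: contrapT => no.
have HF I : ~ minor H (fan F I) by move=> h; apply: no; exists I.
(* The midpoint provides the strict inequality that [fan_max_density] needs. *)
suff : (c_infty R H + x) / 2 <= c_infty R H by lra.
apply: le_c_infty; apply: (fan_max_density P0 HF); apply: lt_le_trans w.
by rewrite ltr_pM2r ?ltr0n // ltr_pM2r ?ltr0n //; lra.
Qed.

End MaxDensity.

End Limits.

(** * Disjoint unions *)

Section DisjointMinors.
Import mathcomp.boot.fintype mathcomp.boot.finset.
Local Open Scope set_scope.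
Local Open Scope nat_scope.

Lemma dunion_model (H1 H2 G1 G2 : sgraph) :
  model H1 G1 -> model H2 G2 -> model (dunion H1 H2) (dunion G1 G2).
Proof.
move=> [phi1 [ex1 C1 E1]] [phi2 [ex2 C2 E2]].
pose phi (x : dunion G1 G2) : option (dunion H1 H2) :=
  match x with inl a => omap inl (phi1 a) | inr b => omap inr (phi2 b) end.
have phil a h : phi (inl a) = Some (inl h) <-> phi1 a = Some h.
  by rewrite /phi; case: (phi1 a) => [h'|] //=; split=> [[->]|[->]].
have phir a h : phi (inr a) = Some (inr h) <-> phi2 a = Some h.
  by rewrite /phi; case: (phi2 a) => [h'|] //=; split=> [[->]|[->]].
exists phi; split.
- move=> [h|h]; first by have [x /phil] := ex1 h; exists (inl x).
  by have [x /phir] := ex2 h; exists (inr x).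
- move=> [h|h] x y; rewrite !inE => /eqP + /eqP.
    case: x => [x|x]; last by rewrite /phi; case: (phi2 x).
    case: y => [y|y]; last by rewrite /= => _; case: (phi2 y).
    move=> /phil xh /phil yh; have := C1 h x y; rewrite !inE xh yh eqxx => /(_ isT isT).
    apply: connect_homo => z t /and3P[zt]; rewrite !inE => /eqP/phil zh /eqP/phil th.
    by apply: connect1; rewrite adj_inE !inE zh th eqxx !andbT.
  case: x => [x|x]; first by rewrite /phi; case: (phi1 x).
  case: y => [y|y]; first by rewrite /= => _; case: (phi1 y).
  move=> /phir xh /phir yh; have := C2 h x y; rewrite !inE xh yh eqxx => /(_ isT isT).
  apply: connect_homo => z t /and3P[zt]; rewrite !inE => /eqP/phir zh /eqP/phir th.
  by apply: connect1; rewrite adj_inE !inE zh th eqxx !andbT.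
- move=> [h|h] [h'|h'] //=.
    move=> /E1/touchP[x [y [/phil xh /phil yh xy]]].
    by apply/touchP; exists (inl x), (inl y).
  move=> /E2/touchP[x [y [/phir xh /phir yh xy]]].
  by apply/touchP; exists (inr x), (inr y).
Qed.

Section SplitFan.
Variables (P : sgraph) (T : finType) (F : P -> T -> bool).

Definition sub_roots (S : {set T}) (p : P) (t : {t | t \in S}) : bool := F p (val t).

(** The copies indexed by [I] keep only the roots outside [S] and those indexed by [J] only the
    roots in [S], so the two smaller fans are disjoint. *)
Lemma split_fan (S : {set T}) (I J : finType) :
  subgraph (dunion (fan (@sub_roots (~: S)) I) (fan (@sub_roots S) J))
    (fan F (I + J)%type).
Proof.
exists (fun x : dunion (fan (@sub_roots (~: S)) I) (fan (@sub_roots S) J) =>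
  match x with
  | inl (inl t) => inl (val t)
  | inl (inr (p, i)) => inr (p, inl i)
  | inr (inl t) => inl (val t)
  | inr (inr (p, j)) => inr (p, inr j)
  end : fan F (I + J)%type).
  have disj (t : {t | t \in ~: S}) (t' : {t | t \in S}) : val t <> val t'.
    by move=> E; have := valP t; rewrite E inE (valP t').
  move=> [[t|[p i]]|[t|[p i]]] [[t'|[p' i']]|[t'|[p' i']]] //=.
  - by move=> [/val_inj->].
  - by move=> [/disj].
  - by move=> [-> ->].
  - by move=> [/esym/disj].
  - by move=> [/val_inj->].
  - by move=> [-> ->].
by move=> [[t|[p i]]|[t|[p i]]] [[t'|[p' i']]|[t'|[p' i']]].
Qed.

Lemma sub_roots_weight (S : {set T}) :
  fan_weight (@sub_roots S) = arcs P + 2 * \sum_p \sum_(t in S) (F p t : nat).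
Proof.
rewrite /fan_weight; congr (_ + 2 * _); apply: eq_bigr => p _.
by rewrite -(sum_sig (fun t => t \in S) (fun t => nat_of_bool (F p t))).
Qed.

Lemma fan_weight_le (S : {set T}) :
  fan_weight F <= fan_weight (@sub_roots (~: S)) + 2 * #|S| * #|P|.
Proof.
rewrite sub_roots_weight -addnA leq_add2l -mulnA -mulnDr leq_mul2l /=.
rewrite mulnC -sum_nat_const -big_split /=; apply: leq_sum => p _.
rewrite (bigID (fun t => t \in S)) /= addnC leq_add //.
  by rewrite eq_leq //; apply: eq_bigl => t; rewrite inE.
by rewrite -sum1_card; apply: leq_sum => t _; case: (F p t).
Qed.

(* Besides the copy [(h, h)] contracted to the vertex [h] for [h] outside the
   cover, the copy [(h, h')] for [h] in the cover extends the branch set of the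
   root assigned to [h]; it is adjacent to all other roots. *)
Lemma cover_model (H : sgraph) (X : {set H}) (g : H -> T) :
  vertex_cover X -> {in X &, injective g} -> (forall p p' : P, connect (@adj P) p p') ->
  0 < #|P| -> (forall t, exists p, F p t) ->
  model H (fan (@sub_roots (g @: X)) (H * H)%type).
Proof.
move=> Xcov ginj Pconn /card_gt0P[p0 _] rooted.
have cov h h' : adj h h' -> (h \in X) || (h' \in X).
  move=> hh'; apply: contraT; rewrite negb_or => /andP[hX h'X].
  have /forall_inP/(_ h) := Xcov; rewrite inE hX => /(_ isT)/forall_inP/(_ h').
  by rewrite inE h'X hh' => /(_ isT).
set K := fan _ _.
pose phi (v : K) : option H :=
  match v with
  | inl t => [pick h in X | g h == val t]
  | inr (p, (h, h')) => if (h \in X) || (h == h') then Some h else None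
  end.
have phiT t h : phi (inl t) = Some h <-> h \in X /\ g h = val t.
  rewrite /phi; case: pickP => [h' /andP[h'X /eqP gh']|no].
    split=> [[<-]//|[hX gh]]; congr Some; apply: ginj => //.
    by rewrite gh gh'.
  by split=> // -[hX gh]; have := no h; rewrite hX gh eqxx.
have phiP p h1 h2 h : phi (inr (p, (h1, h2))) = Some h <->
    h1 = h /\ ((h1 \in X) || (h1 == h2)).
  by rewrite /phi; case: ifP => _; split=> [|[]] //; [case=> ->|move=> ->].
have gX h : h \in X -> g h \in g @: X by move=> hX; rewrite imset_f.
pose root h (hX : h \in X) : {t | t \in g @: X} := exist _ (g h) (gX h hX).
have phi_root h (hX : h \in X) : phi (inl (root h hX)) = Some h by apply/phiT.
have copy_conn h h1 h2 p p' : phi (inr (p, (h1, h2))) = Some h ->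
    connect (adj_in (fib phi h)) (inr (p, (h1, h2))) (inr (p', (h1, h2))).
  move=> /phiP ph; have := Pconn p p'.
  apply: (connect_homo (f := fun p => inr (p, (h1, h2)) : K)) => x y xy.
  apply: connect1; rewrite adj_inE !inE.
  have -> : phi (inr (x, (h1, h2))) = Some h by apply/phiP.
  have -> : phi (inr (y, (h1, h2))) = Some h by apply/phiP.
  by rewrite eqxx !andbT /= eqxx.
have copy_root h (hX : h \in X) p h' : connect (adj_in (fib phi h))
    (inr (p, (h, h'))) (inl (root h hX)).
  have ph q : phi (inr (q, (h, h'))) = Some h by apply/phiP; rewrite hX.
  have [q qt] := rooted (g h).
  apply: (connect_trans (copy_conn _ _ _ p q (ph p))).
  by apply: connect1; rewrite adj_inE !inE ph phi_root eqxx !andbT.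
exists phi; split.
- by move=> h; exists (inr (p0, (h, h))); apply/phiP; rewrite eqxx orbT.
- move=> h; have [hX|hX] := boolP (h \in X).
    have to_root v : v \in fib phi h -> connect (adj_in (fib phi h)) v (inl (root h hX)).
      rewrite inE; case: v => [t|[p [h1 h2]]] /eqP.
        move=> /phiT[_ gh]; have -> : t = root h hX by apply: val_inj.
        exact: connect0.
      by move=> /phiP[-> _]; apply: copy_root.
    by move=> x y /to_root hx /to_root hy; apply: connect_trans hx _; rewrite adj_in_sym.
  have only v : v \in fib phi h -> exists p, v = inr (p, (h, h)).
    rewrite inE; case: v => [t|[p [h1 h2]]] /eqP.
      by move=> /phiT[]; rewrite (negbTE hX).
    by move=> /phiP[->]; rewrite (negbTE hX) => /eqP <-; exists p.
  move=> x y /[dup] xf /only[p xE] /only[p' ->]; rewrite xE in xf *.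
  by apply: copy_conn; apply/eqP; rewrite inE in xf.
have edge h h' : adj h h' -> h \in X -> touch phi h' h.
  move=> hh' hX; have [q qt] := rooted (g h).
  (* Every copy of [P] has a neighbour of the root of [h], so any copy in the branch set of [h']
     serves; outside the cover the only one is [(h', h')]. *)
  apply/touchP; exists (inr (q, (h', if h' \in X then h else h'))), (inl (root h hX)).
  split=> //; apply/phiP; split=> //.
  by case: (h' \in X) => //; rewrite eqxx.
move=> h h' hh'; have /orP[hX|h'X] := cov _ _ hh'.
  by rewrite touch_sym; apply: edge.
by apply: edge; rewrite // adj_sym.
Qed.

End SplitFan.

(** Each edge of [H] is realised by an edge of [G] with an end in [Y], so the labels occurring on
    [Y] cover [H]. *)
Lemma model_cover (H G : sgraph) (Y : {set G}) :
  model H G -> vertex_cover Y -> exists2 X : {set H}, vertex_cover X & #|X| <= #|Y|.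
Proof.
move=> [phi [_ _ phiE]] Ycov; exists [set h | Some h \in phi @: Y].
  apply/forall_inP => h; rewrite !inE => hX; apply/forall_inP => h'; rewrite !inE => h'X.
  apply/negP => /phiE/touchP[x [y [xh yh xy]]].
  have xY : x \in ~: Y by rewrite inE; apply: contra hX => xY; rewrite -xh imset_f.
  have yY : y \in ~: Y by rewrite inE; apply: contra h'X => yY; rewrite -yh imset_f.
  have /forall_inP/(_ x xY)/forall_inP/(_ y yY) := Ycov.
  by rewrite xy.
apply: leq_trans (leq_imset_card phi Y).
have Some_injH : injective (@Some H) by move=> h h' [].
rewrite -(card_imset _ Some_injH); apply: subset_leq_card.
by apply/subsetP => _ /imsetP[h + ->]; rewrite inE.
Qed.

Lemma tauP (H : sgraph) : exists2 X : {set H}, vertex_cover X &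
  tau H = #|X| /\ forall Y : {set H}, vertex_cover Y -> #|X| <= #|Y|.
Proof.
rewrite /tau; case: arg_minnP => [|X Xcov Xmin]; first exact: vertex_coverT.
by exists X.
Qed.

(** Here [P] is a single vertex, so the fan is complete bipartite and its [n] roots form a vertex
    cover. *)
Lemma star_fan_free (H : sgraph) (n : nat) (I : finType) : n < tau H ->
  ~ minor H (fan (fun (p : complete unit) (t : 'I_n) => true) I).
Proof.
move=> nt /minor_model HF; have [X _ [tX Xmin]] := tauP H.
set G := fan _ _ in HF; pose Y : {set G} := [set x | if x is inl _ then true else false].
have Ycov : vertex_cover Y.
  apply/forall_inP => -[t|[p i]]; rewrite !inE // => _.
  apply/forall_inP => -[t|[q j]]; rewrite !inE // => _.
  by case: p q => [] [] /=; rewrite andbF.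
have [Z Zcov leZ] := model_cover HF Ycov.
have Yn : #|Y| <= n.
  have -> : Y = [set (inl t : G) | t in [set: 'I_n]].
    apply/setP => -[t|[p i]]; rewrite inE; apply/esym; first by rewrite imset_f.
    by apply/negbTE/imsetP => -[].
  by apply: leq_trans (leq_imset_card _ _) _; rewrite cardsT card_ord.
have := leq_trans (Xmin _ Zcov) (leq_trans leZ Yn).
by rewrite -tX leqNgt nt.
Qed.

End DisjointMinors.

(** * Bounds on the asymptotic extremal function *)

Section Bounds.
Import mathcomp.boot.fintype mathcomp.boot.finset.
Local Open Scope set_scope.
Local Open Scope ring_scope.

(** Complete bipartite graphs with one side of size [(tau H).-1] avoid [H], and their density tends
    to [(tau H).-1] as the other side grows. *)
Lemma tau_le_c_infty (R : realType) (H : sgraph) : (tau H)%:R <= c_infty R H + 1.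
Proof.
have [->|t0] := posnP (tau H); first by rewrite addr_ge0 ?c_infty_ge0.
have tE : (tau H)%:R = ((tau H).-1)%:R + 1 :> R by rewrite natr1 prednK.
rewrite tE lerD2r leNgt; apply/negP => lt.
have [I] : exists I : finType,
    minor H (fan (fun (p : complete unit) (t : 'I_(tau H).-1) => true) I).
  have card1 : #|complete unit| = 1%N by apply: card_unit.
  apply: (dense_fan_minor (R := R) (x := ((tau H).-1)%:R)) => //; first by rewrite card1.
  rewrite card1 mulr1 /fan_weight natrD natrM.
  have -> : \sum_(p : complete unit) \sum_(t < (tau H).-1) (true : nat) = (tau H).-1.
    under eq_bigr do rewrite sum_nat_const muln1 card_ord.
    by rewrite sum_nat_const card1 mul1n.
  by rewrite mulrC lerDr.
by apply: star_fan_free; rewrite prednK.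
Qed.

(* A dense fan splits along a set [S] of at most [tau H2] roots: the copies kept
   with the roots outside [S] still have density exceeding that forcing [H1],
   while [S] with finitely many other copies contains [H2], because of density if
   [S] consists of all roots, and by contracting copies otherwise. *)
Lemma c_infty_dunion (R : realType) (H1 H2 : sgraph) :
  c_infty R (dunion H1 H2) <=
    Num.max (c_infty R H2) (c_infty R H1 + (tau H2)%:R).
Proof.
set c := c_infty R (dunion H1 H2); set b := Num.max _ _.
rewrite leNgt; apply/negP => bc.
have b0 : 0 <= b by rewrite le_max c_infty_ge0.
have b2 : c_infty R H2 <= b by rewrite le_max lexx.
have b1 : c_infty R H1 + (tau H2)%:R <= b by rewrite le_max lexx orbT.
(* Any two values with [b < d' < d < c] would do: [d] is reached by graphs avoiding the union, [d']
   by fans. *)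
pose d' := b + (c - b) / 3; pose d := b + (c - b) / 2.
have d0 : 0 < d by rewrite /d; lra.
have d'0 : 0 <= d' by rewrite /d'; lra.
have d'd : d' < d by rewrite /d /d'; lra.
have dc : d < c by rewrite /d; lra.
have bd' : b < d' by rewrite /d'; lra.
have dense N : exists2 n, (N <= n)%N & d <= max_density R (dunion H1 H2) n.
  have [M h] := lt_c_infty dc; exists (maxn N M); first exact: leq_maxl.
  by apply: h; apply: leq_maxr.
have [P [T [F [P0 Pconn rooted HF w]]]] := fan_exists d'0 d'd (dense_graphs d0 dense).
have [X Xcov [tX _]] := tauP H2.
have [S St [I HI]] : exists2 S : {set T}, (#|S| <= tau H2)%N &
    exists I, minor H2 (fan (@sub_roots P T F S) I).
  have [Tt|tT] := leqP #|T| (tau H2).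
    exists setT; first by rewrite cardsT.
    apply: (dense_fan_minor (x := d')) => //; first exact: le_lt_trans bd'.
    apply: le_trans w _; rewrite ler_nat sub_roots_weight leq_add2l leq_mul2l /=.
    apply: leq_sum => p _; rewrite eq_leq //; apply: eq_bigl => t.
    by rewrite inE.
  have [t0 _] : exists t0 : T, t0 \in T.
    by apply/card_gt0P; apply: leq_ltn_trans (leq0n _) tT.
  (* Distinct roots for the cover vertices, matched by position in the two enumerations. *)
  pose g h := nth t0 (enum T) (index h (enum X)).
  have gi h : h \in X -> (index h (enum X) < size (enum T))%N.
    by move=> hX; rewrite -cardE (ltn_trans _ tT) // tX [#|X|]cardE index_mem mem_enum.
  have ginj : {in X &, injective g}.
    move=> h h' hX h'X /eqP; rewrite nth_uniq ?enum_uniq ?gi // => /eqP E.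
    by rewrite -(nth_index h (s := enum X) (x := h)) ?mem_enum // E nth_index // mem_enum.
  exists (g @: X); first by rewrite tX leq_imset_card.
  exists (H2 * H2)%type; apply: model_minor.
  exact: cover_model Xcov ginj Pconn P0 rooted.
have [J HJ] : exists J, minor H1 (fan (@sub_roots P T F (~: S)) J).
  (* Each vertex of [P] loses at most [tau H2] edges to roots, so the density drops by at most
     [tau H2] and stays above [c_infty R H1]. *)
  apply: (dense_fan_minor (x := d' - (tau H2)%:R)) => //; first by move: b1 bd'; lra.
  have := fan_weight_le F S; rewrite -(ler_nat R) natrD !natrM => wS.
  have : #|S|%:R * #|P|%:R <= (tau H2)%:R * #|P|%:R :> R by rewrite ler_wpM2r // ler_nat.
  by move: w wS; lra.
apply: (HF (J + I)%type); apply: minor_subgraph (split_fan F S J I) _.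
by apply/model_minor/dunion_model; apply: minor_model.
Qed.

End Bounds.

Local Open Scope ring_scope.

Theorem theorem1p2 (R : realType) (H1 H2 : sgraph)
    (H1_nonnull : (0 < #|H1|)%N) (H2_nonnull : (0 < #|H2|)%N) :
  c_infty R (dunion H1 H2) <=
    Num.max (c_infty R H2) (c_infty R H1 + (tau H2)%:R) /\
  c_infty R (dunion H1 H2) <= c_infty R H1 + c_infty R H2 + 1.
Proof.
split; first exact: c_infty_dunion.
apply: le_trans (c_infty_dunion R H1 H2) _.
rewrite ge_max; apply/andP; split.
  by rewrite -addrA addrCA lerDl addr_ge0 ?c_infty_ge0.
by rewrite -addrA lerD2l tau_le_c_infty.
Qed.
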